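(* Let $I$ be an infinite set of positive integers and for each $n \in I$ let $H_n \le S_n$ be a primitive subgroup with $H_n \neq A_n$ and $H_n \neq S_n$. Then the family $(S_n, H_n)_{n \in I}$ is indistinguishable.
   Context: For a finite group $G$, let $\mathrm{Irr}(G)$ be its set of complex irreducible characters and $d_\chi=\chi(e)$. For $H \le G$ let $D_H = \frac{1}{|G|}\sum_{\chi \in \mathrm{Irr}(G)} d_\chi \big|\sum_{h \in H, h \neq e}\chi(h)\big|$ (the $L_1$ distance between the distributions $P_H(\chi)=\frac{d_\chi}{|G|}\sum_{h\in H}\chi(h)$ and $P_{\{e\}}$ on $\mathrm{Irr}(G)$ produced by weak quantum Fourier sampling). A family $(G_i,H_i)_{i \in I}$ with $H_i \le G_i$, $I$ an infinite set of positive integers and $|G_i| \to \infty$, is called distinguishable if there is a constant $c>0$ such that $D_{H_i} \ge (\log|G_i|)^{-c}$ for all sufficiently large $i \in I$, and indistinguishable otherwise. $S_n$ and $A_n$ are the symmetric and alternating groups on $\{1,\ldots,n\}$. A subgroup $H \le S_n$ is primitive if it acts transitively on $\{1,\ldots,n\}$ and preserves no nontrivial partition of $\{1,\ldots,n\}$ (i.e. no partition other than the one into singletons and the one with a single block). *)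

(* Defs.v *)
From HB Require Import structures.
From mathcomp Require Import all_boot all_order all_algebra all_fingroup.
From mathcomp Require Import all_solvable all_field all_character.
From mathcomp Require Import all_classical all_reals all_analysis.

Set Implicit Arguments.
Unset Strict Implicit.
Unset Printing Implicit Defensive.

Import Order.TTheory GRing.Theory Num.Theory.
Local Open Scope ring_scope.
Local Open Scope classical_set_scope.

Definition algC_to_real (R : realType) (x : algC) : R :=
  sup [set (ratr q : R) | q in [set q : rat | (ratr q : algC) <= x]].

Definition D_H (gT : finGroupType) (G H : {group gT}) : algC :=
  (#|G|%:R)^-1 *
  \sum_(i : Iirr G) 'chi[G]_i 1%g * `| \sum_(h in H :\ 1%g) 'chi[G]_i h |.

Definition distinguishable (R : realType) (I : pred nat)
    (gT : nat -> finGroupType) (G H : forall n, {group gT n}) : Prop :=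
  exists c : R, 0 < c /\ exists N : nat, forall n, I n -> (N <= n)%N ->
    powR (ln (#|G n|%:R : R)) (- c) <= algC_to_real R (D_H (G n) (H n)).

Definition indistinguishable (R : realType) (I : pred nat)
    (gT : nat -> finGroupType) (G H : forall n, {group gT n}) : Prop :=
  ~ distinguishable R I G H.

Definition infinite_natset (I : pred nat) : Prop :=
  forall m : nat, exists n : nat, (m < n)%N /\ I n.

(* Main.v *)
(** Cauchy-Schwarz and the second orthogonality relation give
    D_H^2 <= sum_{h in H#} |h^G cap H| / |h^G|.  This sum is at most n^-M as soon
    as H is transitive with a base of b <= n / C(M) points.  Indeed an element h
    with k moved points moves on average bk/n points of the H-translates of the
    base, and it is determined by its action on such a translate, so H contains
    at most 2 (bn)^(2bk/n) elements moving k points, whereas h has at least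
    about n^(k/8) conjugates in S_n.  Moreover k >= n/b for every h != 1.

    So everything reduces to showing that a primitive group H other than A_n and
    S_n has a base of size o(n).  A random set of tuples yields such a base when
    every pair x != y is separated by many tuples p, i.e., lies in different
    orbits of the pointwise stabiliser of p.
    - If H is not 2-transitive, one-point tuples suffice (Babai): every pair is
      separated by at least n^(1/4) points.
    - If H is 2-transitive, all pairs x != y are separated by the same number of
      i-tuples.  If for some i < j (with j close to n^(1/4)) this is at least a
      fraction 1/(4j) of them, we have a small base.  Otherwise some orbit of H
      contains 3/4 of all j-tuples, so H induces every permutation of some j
      points; but some of these have order > n^8, while by Bochert's theorem
      nontrivial elements of H move more than n/8 points, which forces their
      orders to be at most n^8. *)

Require Import Defs.
From HB Require Import structures.
From mathcomp Require Import all_boot all_order all_algebra all_fingroup.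
From mathcomp Require Import all_solvable all_field all_character.
From mathcomp Require Import zify ring lra.
From mathcomp Require boolp.

Set Implicit Arguments.
Unset Strict Implicit.
Unset Printing Implicit Defensive.
Import Order.TTheory GRing.Theory Num.Theory GroupScope.

(** * Cauchy-Schwarz and orthogonality bound for [D_H] *)

Section Characters.
Local Open Scope ring_scope.

(** Lagrange's identity: the squares of [a i * b j - a j * b i] add up to twice the defect. *)
Lemma real_cauchy_schwarz (F : numDomainType) (I : finType) (a b : I -> F) :
    (forall i, a i \is Num.real) -> (forall i, b i \is Num.real) ->
  (\sum_i a i * b i) ^+ 2 <= (\sum_i a i ^+ 2) * (\sum_i b i ^+ 2).
Proof.
move=> ra rb.
have : 0 <= \sum_i \sum_j (a i * b j - a j * b i) ^+ 2.
  apply: sumr_ge0 => i _; apply: sumr_ge0 => j _.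
  by rewrite real_exprn_even_ge0 // rpredB // rpredM.
have -> : \sum_i \sum_j (a i * b j - a j * b i) ^+ 2 =
   ((\sum_i a i ^+ 2) * (\sum_i b i ^+ 2) - (\sum_i a i * b i) ^+ 2) *+ 2.
  have E1 : (\sum_i a i ^+ 2) * (\sum_i b i ^+ 2) =
    \sum_i \sum_j a i ^+ 2 * b j ^+ 2 by rewrite big_distrlr.
  have E2 : (\sum_i a i ^+ 2) * (\sum_i b i ^+ 2) =
    \sum_i \sum_j b i ^+ 2 * a j ^+ 2 by rewrite mulrC big_distrlr.
  rewrite mulr2n {1}E1 E2 expr2 big_distrlr /= -!sumrB -big_split /=.
  apply: eq_bigr => i _; rewrite -!sumrB -big_split /=.
  by apply: eq_bigr => j _; ring.
by rewrite pmulrn_lge0 // subr_ge0.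
Qed.

Lemma D_H_ge0 (gT : finGroupType) (G H : {group gT}) : 0 <= D_H G H.
Proof.
rewrite /D_H mulr_ge0 ?invr_ge0 ?ler0n // sumr_ge0 // => i _.
by rewrite mulr_ge0 ?normr_ge0 // ltW ?irr1_gt0.
Qed.

(** The squared degrees sum to [#|G|], cancelling one of the two factors [#|G|^-1]. When the squared
    norms are expanded, second orthogonality leaves [#|'C_G[h]|] for each conjugate pair, and
    [#|'C_G[h]| / #|G|] is the inverse of the class size. *)
Lemma D_H_sqr_le (gT : finGroupType) (G H : {group gT}) : H \subset G ->
  D_H G H ^+ 2 <=
    \sum_(h in H^#) #|(h ^: G) :&: H|%:R / #|h ^: G|%:R.
Proof.
move=> sHG.
have G0 : (#|G|%:R : algC) != 0 by rewrite pnatr_eq0 -lt0n cardG_gt0.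
rewrite /D_H exprMn.
set S := fun i : Iirr G => \sum_(h in H^#) 'chi_i h.
have CS : (\sum_(i : Iirr G) 'chi_i 1%g * `|S i|) ^+ 2 <=
    (\sum_(i : Iirr G) 'chi_i 1%g ^+ 2) * (\sum_(i : Iirr G) `|S i| ^+ 2).
  apply: real_cauchy_schwarz => i; last exact: normr_real.
  by apply: ger0_real; rewrite ltW ?irr1_gt0.
apply: le_trans (ler_wpM2l _ CS) _; first by rewrite exprn_ge0 ?invr_ge0 ?ler0n.
rewrite irr_sum_square mulrA [_ ^+ 2 * _]mulrC exprVn expr2 invfM mulVKf //.
suff -> : \sum_(i : Iirr G) `|S i| ^+ 2 =
   \sum_(h in H^#) #|'C_G[h]|%:R * #|(h ^: G) :&: H^#|%:R.
  rewrite big_distrr /=; apply: ler_sum => h /setD1P[_ Hh].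
  have Gh := subsetP sHG _ Hh.
  rewrite mulrA mulrC -index_cent1 -(Lagrange (subcent1_sub h G)) natrM.
  rewrite invfM mulrAC mulVf ?pnatr_eq0 -?lt0n ?cardG_gt0 // mul1r.
  rewrite ler_wpM2r ?invr_ge0 ?ler0n // ler_nat subset_leq_card //.
  by rewrite setIS // subD1set.
transitivity (\sum_(h in H^#) \sum_(k in H^#)
    \sum_(i : Iirr G) 'chi_i h * ('chi_i k)^*).
  under [RHS]eq_bigr => h _ do rewrite exchange_big.
  rewrite exchange_big; apply: eq_bigr => i _ /=.
  by rewrite normCK /S rmorph_sum big_distrlr.
apply: eq_bigr => h /setD1P[_ Hh].
under eq_bigr => k /setD1P[_ Hk].
  rewrite second_orthogonality_relation ?(subsetP sHG) // mulrb.
  over.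
rewrite -big_mkcondr sumr_const mulr_natr; congr (_ *+ _).
apply: eq_card => k; rewrite !inE andbC class_sym; congr (_ && _).
by rewrite !inE.
Qed.

End Characters.

(** * Moved points, conjugates and class sizes *)

Definition moved (T : finType) (h : {perm T}) : {set T} := [set x | h x != x].

Section Fibers.
Variables (T S : finType) (H : {group {perm T}}) (X : {set S}).
Variable F : {perm T} -> S.
Hypothesis FX : forall g, g \in H -> F g \in X.
Hypothesis Ftr : forall s s', s \in X -> s' \in X ->
  exists2 a, a \in H & forall g, g \in H -> F g = s -> F (g * a) = s'.

(** Right multiplication by the element [a] of [Ftr] embeds one fibre of [F] in another, so all
    fibres over [X] have the same size. *)
Lemma card_fiber s : s \in X -> (#|[set g in H | F g == s]| * #|X| = #|H|)%N.
Proof.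
have le s1 s2 : s1 \in X -> s2 \in X ->
    (#|[set g in H | F g == s1]| <= #|[set g in H | F g == s2]|)%N.
  move=> X1 X2; have [a Ha Fa] := Ftr X1 X2.
  rewrite -(card_imset _ (mulIg a)); apply: subset_leq_card.
  apply/subsetP=> _ /imsetP[g /setIdP[Hg /eqP Fg] ->].
  by rewrite inE groupM //=; apply/eqP/Fa.
move=> Xs; rewrite -(sum1_card (mem H)) (partition_big F (mem X)) //=.
rewrite (eq_bigr (fun=> #|[set g in H | F g == s]|)) => [|s' Xs'].
  by rewrite sum_nat_const mulnC.
by rewrite sum1dep_card; apply/eqP; rewrite eqn_leq !le.
Qed.

End Fibers.

Lemma mem_moved (T : finType) (h : {perm T}) x : (x \in moved h) = (h x != x).
Proof. by rewrite inE. Qed.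

Lemma moved_conj (T : finType) (h g : {perm T}) : moved (h ^ g) = g @: moved h.
Proof.
apply/setP=> x; rewrite -(permKV g x) mem_imset ?mem_moved; last exact: perm_inj.
by rewrite permJ (inj_eq perm_inj).
Qed.

Lemma card_moved_conj (T : finType) (h g : {perm T}) :
  #|moved (h ^ g)| = #|moved h|.
Proof. by rewrite moved_conj card_imset //; apply: perm_inj. Qed.

Lemma moved_eq0 (T : finType) (h : {perm T}) : (moved h == set0) = (h == 1).
Proof.
apply/eqP/eqP=> [h0|->]; last by apply/setP=> x; rewrite !inE perm1 eqxx.
apply/permP=> x; rewrite perm1; apply/eqP.
by have := in_set0 x; rewrite -h0 mem_moved => /negbFE.
Qed.

Section Near.
Variables (T : finType) (b : nat) (w : {ffun 'I_b -> T}).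
Hypothesis b_gt0 : (0 < b)%N.

(** A Hamming ball around [w]: a word at distance at most [t.+1] arises from one at distance at most
    [t] by overwriting one of [b] entries with one of [#|T|] values. *)
Lemma card_near t :
  (#|[set v : {ffun 'I_b -> T} | #|[set i | v i != w i]| <= t]|
     <= (b * #|T|) ^ t)%N.
Proof.
elim: t => [|t IHt].
  rewrite expn0 -(cards1 w); apply/subset_leq_card/subsetP=> v.
  rewrite !inE leqn0 cards_eq0 => /eqP v0; apply/eqP/ffunP=> i.
  by apply/eqP; have := in_set0 i; rewrite -v0 inE => /negbFE.
set N := [set v | _] in IHt.
pose upd (v : {ffun 'I_b -> T}) (p : 'I_b * T) :=
  [ffun i => if i == p.1 then p.2 else v i].
apply: leq_trans (_ : #|(fun q => upd q.1 q.2) @: setX N [set: 'I_b * T]| <= _)%N.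
  apply/subset_leq_card/subsetP=> v; rewrite inE => vt.
  have [D0|[i iD]] := set_0Vmem [set i | v i != w i].
    (* Here [v = w], and entry 0 is overwritten with its own value. *)
    apply/imsetP; exists (v, (Ordinal b_gt0, v (Ordinal b_gt0))); rewrite ?inE /=.
      by rewrite D0 cards0.
    by apply/ffunP=> i; rewrite ffunE /=; case: eqP => // ->.
  apply/imsetP; exists (upd v (i, w i), (i, v i)); rewrite ?inE /= ?andbT.
    rewrite (cardsD1 i) iD ltnS in vt; apply: leq_trans vt.
    apply/subset_leq_card/subsetP=> j; rewrite !inE ffunE /=.
    by case: (j =P i) => [-> |//]; rewrite eqxx.
  by apply/ffunP=> j; rewrite !ffunE /=; case: eqP => // ->.
apply: leq_trans (leq_imset_card _ _) _.
by rewrite cardsX cardsT card_prod card_ord expnSr leq_mul.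
Qed.

End Near.

Lemma ex_perm_map (T : finType) (s1 s2 : seq T) :
  uniq s1 -> uniq s2 -> size s1 = size s2 -> exists g : {perm T}, map g s1 = s2.
Proof.
move=> u1 u2 sz.
pose t1 := Tuple (introT eqP (erefl (size s1))).
pose t2 := Tuple (introT eqP (esym sz)).
have d1 : t1 \in (size s1).-dtuple([set: T]).
  by rewrite inE u1; apply/subsetP=> x; rewrite inE.
have d2 : t2 \in (size s1).-dtuple([set: T]).
  by rewrite inE u2; apply/subsetP=> x; rewrite inE.
have le_s1 : (size s1 <= #|T|)%N by rewrite -(card_uniqP u1) max_card.
have [g _ t12] := atransP2 (ntransitive_weak le_s1 (Sym_trans T)) d1 d2.
by exists g; have /= := congr1 val t12.
Qed.

Section ClassSize.
Variables (T : finType) (h : {perm T}).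

(* A maximal [A] with the first two properties works: by maximality [moved h] is
   covered by [A], [h @: A] and [h @^-1: A]. *)
Lemma ex_displaced_set : exists A : {set T},
  [/\ A \subset moved h, [disjoint A & h @: A] & (#|moved h| <= 3 * #|A|)%N].
Proof.
pose P (A : {set T}) := (A \subset moved h) && [disjoint A & h @: A].
have P0 : P set0 by rewrite /P sub0set imset0 -setI_eq0 setI0 eqxx.
have [A /maxsetP[/andP[Am Ad] maxA] _] := maxset_exists P0.
exists A; split=> //.
have sub : moved h \subset A :|: h @: A :|: h @^-1: A.
  apply/subsetP=> x xm; rewrite !inE; apply/negPn/negP.
  rewrite !negb_or => /andP[/andP[xA xhA] hxA].
  case/negP: xA; rewrite -(maxA (x |: A)) ?subsetUr ?setU11 //.
  rewrite /P subUset sub1set xm Am /=.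
  rewrite imsetU1 -setI_eq0; apply/eqP/setP=> y; rewrite !inE.
  apply/negP=> /andP[/orP[/eqP->|yA] /orP[/eqP yE|yhA]].
  - by move: xm; rewrite mem_moved -yE eqxx.
  - by rewrite yhA in xhA.
  - by rewrite -yE yA in hxA.
  by move/disjointFr: Ad => /(_ _ yA); rewrite yhA.
apply: leq_trans (subset_leq_card sub) _.
have [+ _] := leq_card_setU (A :|: h @: A) (h @^-1: A).
have [+ _] := leq_card_setU A (h @: A).
rewrite (card_imset (mem A) (@perm_inj _ h)).
have -> : #|h @^-1: A| = #|A|.
  rewrite -[RHS](card_imset _ (@perm_inj _ h^-1)); apply: eq_card => x.
  by rewrite inE -{2}(permK h x) mem_imset //; apply: perm_inj.
move=> le1 le2; apply: leq_trans le2 _.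
by rewrite 2!mulSn mul1n addnA leq_add2r.
Qed.

(* With [A] as above, conjugates of [h] can send [c] points of [A] to any [c]
   distinct points outside of them. *)
Lemma class_size_ge c : (3 * c < #|moved h| + 3)%N ->
  ((#|T| - c) ^_ c <= #|h ^: [set: {perm T}]|)%N.
Proof.
have [A [Am Ad kA]] := ex_displaced_set => ck.
have cA : (c <= #|A|)%N by lia.
pose s := take c (enum A).
have sz_s : size s = c by rewrite size_takel // -cardE.
have us : uniq s by rewrite take_uniq ?enum_uniq.
have sA x : x \in s -> x \in A by move/mem_take; rewrite mem_enum.
have us2 : uniq (s ++ map h s).
  rewrite cat_uniq us map_inj_uniq ?us ?andbT /=; last exact: perm_inj.
  apply/hasPn=> _ /mapP[x xs ->]; apply/negP=> /sA hxA.
  by move/disjointFr: Ad => /(_ _ hxA); rewrite imset_f // sA.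
have -> : (#|T| - c = #|[predC s]|)%N.
  by rewrite -sz_s -(card_uniqP us) -(cardC (mem s)) addKn.
rewrite -card_uniq_tuples.
pose f (p : {perm T}) := [tuple of map p (Tuple (introT eqP sz_s))].
apply: leq_trans (leq_imset_card f _); apply/subset_leq_card/subsetP=> v.
rewrite inE => /andP[vs uv].
have uv2 : uniq (s ++ v).
  rewrite cat_uniq us uv andbT /=; apply/hasPn=> x xv.
  by move/allP: vs => /(_ _ xv).
have [g gs] : exists g : {perm T}, map g (s ++ map h s) = s ++ v.
  by apply: ex_perm_map => //; rewrite !size_cat size_map size_tuple sz_s.
(* As [g] fixes [s] pointwise and carries [map h s] to [v], the conjugate [h ^ g] maps [s] to
   [v]. *)
apply/imsetP; exists (h ^ g); first by rewrite memJ_class ?inE.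
apply/val_inj => /=.
have [gs1 gs2] : map g s = s /\ map g (map h s) = v.
  move/eqP: gs; rewrite map_cat eqseq_cat ?size_map //.
  by case/andP=> /eqP ? /eqP ?.
rewrite -gs2 -[in RHS]gs1 -!map_comp; apply: eq_map => x /=.
by rewrite permJ.
Qed.
End ClassSize.

Lemma ltn_sum (I : finType) (P : pred I) (E F : I -> nat) i0 : P i0 ->
    (forall i, P i -> E i < F i)%N ->
  (\sum_(i | P i) E i < \sum_(i | P i) F i)%N.
Proof.
move=> Pi0 ltEF; rewrite (bigD1 i0) // [X in (_ < X)%N](bigD1 i0) //= -addSn.
by rewrite leq_add ?ltEF // leq_sum // => i /andP[/ltEF/ltnW].
Qed.

(** * Groups with a small base *)

Section SmallBase.
Variables (T : finType) (H : {group {perm T}}) (b : nat) (B : 'I_b -> T).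
Hypothesis trH : forall x y, exists2 g, g \in H & g x = y.
Hypothesis baseB : forall h, h \in H -> (forall i, h (B i) = B i) -> h = 1.
Hypothesis b_gt0 : (0 < b)%N.

Lemma card_transporter x y : (#|[set g in H | g x == y]| * #|T| = #|H|)%N.
Proof.
rewrite -cardsT.
apply: (card_fiber (F := fun g : {perm T} => g x)) => [g _|s s' _ _|].
- by rewrite inE.
- by have [a Ha as'] := trH s s'; exists a => // g _ gs; rewrite permM gs.
by rewrite inE.
Qed.

(* The translate of the base [B] by [g] has [hits g h] points moved by [h]. *)
Definition hits (g h : {perm T}) : nat := #|[set i | g (B i) \in moved h]|.

(** By transitivity [g (B i)] is uniformly distributed on [T] for uniform [g] in [H], so the mean
    number of hits is [b * #|moved h| / #|T|]. *)
Lemma sum_hits h : (#|T| * \sum_(g in H) hits g h = b * #|moved h| * #|H|)%N.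
Proof.
rewrite /hits; under eq_bigr => g _ do rewrite -sum1dep_card big_mkcond.
rewrite exchange_big /=.
under eq_bigr => i _.
  rewrite -big_mkcondr /= (partition_big (fun g : {perm T} => g (B i))
    (mem (moved h))) => [|g /andP[]//].
  under eq_bigr => y hy.
    rewrite (eq_bigl (fun g => (g \in H) && (g (B i) == y))) => [|g]; last first.
      by rewrite andbAC andbC; case: eqP => [->|]; rewrite ?andbF // [_ \in _]hy.
    rewrite sum1dep_card.
    over.
  over.
rewrite mulnC big_distrl /=.
under eq_bigr => i _.
  rewrite big_distrl /=.
  under eq_bigr => y _ do rewrite card_transporter.
  rewrite sum_nat_const.
  over.
by rewrite sum_nat_const card_ord mulnA.
Qed.

Lemma hits_gt0 g h : g \in H -> h \in H -> h != 1 -> (0 < hits g h)%N.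
Proof.
move=> Hg Hh; apply: contraR; rewrite /hits -leqNgt leqn0 cards_eq0 => /eqP fixB.
suff : h ^ g^-1 = 1 by move/(canRL (conjgKV g)) ->; rewrite conj1g.
apply: baseB => [|i]; first by rewrite groupJ ?groupV.
rewrite -{1}(permK g (B i)) permJ.
have := in_set0 i; rewrite -fixB !inE => /negbFE/eqP ->.
by rewrite permK.
Qed.

(** Every translate of the base is hit at least once, so the mean in [sum_hits] is at least 1. *)
Lemma card_moved_ge h : h \in H -> h != 1 -> (#|T| <= b * #|moved h|)%N.
Proof.
move=> Hh h1; rewrite -(leq_pmul2r (cardG_gt0 H)) -sum_hits leq_pmul2l.
  by rewrite -sum1_card leq_sum // => g Hg; apply: hits_gt0.
by apply/card_gt0P; exists (B (Ordinal b_gt0)).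
Qed.

(** By Markov's inequality each [h] has at most [t] hits, about twice the mean, for at least half of
    the [g] in [H]; exchanging sums gives one [g] that serves half of the [h]. Such an [h] is
    determined by its values on the translate [w] of the base, which form a word in the Hamming ball
    of radius [t] around [w]. *)
Lemma card_moved_class_le k :
  (#|[set h in H | #|moved h| == k]|
     <= 2 * (b * #|T|) ^ (2 * b * k %/ #|T|))%N.
Proof.
set A := [set h in H | _]; set t := (_ %/ _)%N.
have n_gt0 : (0 < #|T|)%N by apply/card_gt0P; exists (B (Ordinal b_gt0)).
have few h : h \in A -> (#|H| <= 2 * #|[set g in H | hits g h <= t]|)%N.
  case/setIdP=> Hh /eqP hk.
  have cH : (#|H| = #|[set g in H | hits g h <= t]|
                  + #|[set g in H | t < hits g h]|)%N.
    rewrite -(cardsID [set g | hits g h <= t] H); congr (_ + _)%N.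
      by apply: eq_card => g; rewrite !inE.
    by apply: eq_card => g; rewrite !inE -ltnNge andbC.
  have := sum_hits h; rewrite hk => sumh.
  have : ((2 * b * k).+1 * #|[set g in H | t < hits g h]| <= b * k * #|H|)%N.
    rewrite -sumh big_distrr /= (bigID (fun g => t < hits g h)) /=.
    apply: leq_trans (leq_addr _ _).
    rewrite -sum1dep_card big_distrr /= leq_sum // => g /andP[_ tg].
    rewrite muln1 (@leq_trans (#|T| * t.+1)) ?leq_mul //.
    by rewrite [leqRHS]mulnC ltn_ceil.
  move: cH; set x := #|[set g in H | _]|; set y := #|[set g in H | _]|.
  by move=> ->; nia.
have [g Hg Ag] : exists2 g, g \in H &
    (#|A| <= 2 * #|[set h in A | hits g h <= t]|)%N.
  apply/exists_inP; apply: contraT.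
  rewrite negb_exists_in => /forall_inP no_g.
  have : (\sum_(g in H) 2 * #|[set h in A | hits g h <= t]| < #|H| * #|A|)%N.
    rewrite -sum_nat_const; apply: (ltn_sum (group1 H)) => g Hg.
    by rewrite ltnNge no_g.
  rewrite ltnNge => /negP[].
  rewrite -big_distrr /=; under eq_bigr => g _ do rewrite -sum1dep_card.
  rewrite (exchange_big_dep (mem A)) /=; last by move=> g h _ /andP[].
  rewrite mulnC -sum_nat_const big_distrr leq_sum //= => h Ah.
  apply: leq_trans (few _ Ah) _; rewrite leq_mul2l /= -sum1dep_card.
  by apply: eq_leq; apply: eq_bigl => g; rewrite Ah.
apply: leq_trans Ag _; rewrite leq_mul2l /=.
pose w := [ffun i => g (B i)].
apply: leq_trans (card_near w b_gt0 t).
pose f (h : {perm T}) := [ffun i => h (w i)].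
rewrite -(@card_in_imset _ _ f).
  apply/subset_leq_card/subsetP=> _ /imsetP[h /setIdP[Ah ht] ->].
  rewrite inE; apply: leq_trans ht; apply/subset_leq_card/subsetP=> i.
  by rewrite !inE !ffunE.
move=> h1 h2 /setIdP[/setIdP[H1 _] _] /setIdP[/setIdP[H2 _] _] /ffunP f12.
apply/eqP; rewrite eq_mulgV1; apply/eqP.
suff : (h1 * h2^-1) ^ g^-1 = 1 by move/(canRL (conjgKV g)) ->; rewrite conj1g.
apply: baseB => [|i]; first by rewrite groupJ ?groupM ?groupV.
rewrite -{1}(permK g (B i)) permJ permM.
have := f12 i; rewrite !ffunE => ->.
by rewrite !permK.
Qed.

Lemma expn_le_ffact m c : ((m.+1 - c) ^ c <= m ^_ c)%N.
Proof.
elim: c m => [|c IHc] [|m] //; first by rewrite subSS sub0n exp0n.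
by rewrite ffactSS subSS expnS leq_mul ?leq_subr ?IHc.
Qed.

(** The count of [card_moved_class_le] is at most [2 * n ^ (2 * t)] with [t] at most
    [2 * k / (16 * M + 168)], whereas the class has at least about [n ^ (k / 8)] elements. In
    [small_base_sum] one factor of the square bounds the part of the class inside [H], and the other
    pays for the summation over [h]. *)
Lemma card_moved_class_sqr_le M h :
    ((16 * M + 168) * b <= #|T|)%N -> h \in H -> h != 1 ->
  (#|[set k in H | #|moved k| == #|moved h|]| ^ 2 * #|T| ^ (M + 2)
     <= #|h ^: [set: {perm T}]|)%N.
Proof.
move=> bn Hh h1; have nk := card_moved_ge Hh h1.
have kn : (#|moved h| <= #|T|)%N by apply: max_card.
have := card_moved_class_le #|moved h|.
set k := #|moved h| in nk kn *; set a := #|_|; set n := #|T| in bn nk kn *.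
set t := (_ %/ _)%N => a_le.
have tn : (t * n <= 2 * b * k)%N by apply: leq_trunc_div.
have n_gt : (168 <= n)%N by nia.
have t_le : ((16 * M + 168) * t <= 2 * k)%N.
  have : (b * ((16 * M + 168) * t) <= b * (2 * k))%N by nia.
  by rewrite leq_pmul2l.
have k_ge : (16 * M + 168 <= k)%N.
  have : (b * (16 * M + 168) <= b * k)%N by nia.
  by rewrite leq_pmul2l.
(* A quarter of [k], rounded up: admissible in [class_size_ge], yet so small that [(n - c).+1 - c]
   is at least the square root of [n]. *)
pose c := ((k + 3) %/ 4)%N.
have [c1 c2] : (k <= 4 * c /\ 4 * c <= k + 3)%N by rewrite /c; lia.
have L_ge : ((n - c) ^_ c <= #|h ^: [set: {perm T}]|)%N.
  by apply: class_size_ge; rewrite -/k; lia.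
apply: leq_trans L_ge; apply: leq_trans (expn_le_ffact _ _).
rewrite -leq_sqr [leqRHS]expnAC.
apply: (@leq_trans (n ^ c)); last by rewrite leq_exp2r; nia.
have bn_le : (b * n <= n ^ 2)%N by nia.
have {}a_le : (a <= 2 * n ^ (2 * t))%N.
  apply: leq_trans a_le _; rewrite leq_mul2l /= expnM.
  by case: (t) => // s; rewrite leq_exp2r.
rewrite expnMn -!expnM.
apply: (@leq_trans ((2 * n ^ (2 * t)) ^ 4 * n ^ ((M + 2) * 2))).
  by rewrite leq_mul2r leq_exp2r // a_le orbT.
rewrite expnMn -expnM.
apply: (@leq_trans (n ^ 1 * n ^ (2 * t * 4) * n ^ ((M + 2) * 2))).
  by rewrite !leq_mul2r expn1 (leq_trans _ n_gt) ?orbT.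
by rewrite -!expnD leq_pexp2l; lia.
Qed.

(** Conjugates move equally many points, so each term is at most [n ^- (M + 2)] divided by the
    number of elements of [H] moving as many points as [h]. Terms with equal [#|moved h|] thus add
    up to at most [n ^- (M + 2)], and [#|moved h|] takes at most [n + 1 <= n ^ 2] values. *)
Lemma small_base_sum (F : numFieldType) M :
    ((16 * M + 168) * b <= #|T|)%N ->
  (\sum_(h in H^#) #|(h ^: [set: {perm T}]) :&: H|%:R / #|h ^: [set: {perm T}]|%:R
     <= (#|T|%:R ^- M) :> F)%R.
Proof.
move=> bn; set n := #|T|.
have n_gt : (168 <= n)%N by rewrite /n; nia.
have n0 : (0 < n%:R :> F)%R by rewrite ltr0n; lia.
pose a k := #|[set h in H | #|moved h| == k]|.
have le1 h : h \in H^# ->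
  (#|(h ^: [set: {perm T}]) :&: H|%:R / #|h ^: [set: {perm T}]|%:R
     <= (a #|moved h|)%:R^-1 * n%:R ^- (M + 2) :> F)%R.
  case/setD1P=> h1 Hh.
  have a0 : (0 < a #|moved h|)%N by apply/card_gt0P; exists h; rewrite inE Hh /=.
  have L0 : (0 < #|h ^: [set: {perm T}]|)%N.
    by apply/card_gt0P; exists h; apply: class_refl.
  rewrite ler_pdivrMr ?ltr0n // -invfM mulrC ler_pdivlMr; last first.
    by rewrite mulr_gt0 ?ltr0n // exprn_gt0.
  rewrite -natrX -!natrM ler_nat.
  apply: leq_trans (card_moved_class_sqr_le bn Hh h1).
  rewrite mulnA leq_mul2r expnS expn1 leq_mul2r; apply/orP; right.
  apply/orP; right; apply/subset_leq_card/subsetP=> _ /setIP[/imsetP[g _ ->] Hg].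
  by rewrite inE Hg card_moved_conj /=.
apply: le_trans (ler_sum _ le1) _.
apply: (@le_trans _ _ (\sum_(h in H) (a #|moved h|)%:R^-1 * n%:R ^- (M + 2))%R).
  rewrite [leRHS](bigD1 1%g) //= (eq_bigl (fun h => (h \in H) && (h != 1%g))).
    by rewrite lerDr mulr_ge0 ?invr_ge0 ?ler0n ?exprn_ge0 ?ltW.
  by move=> h; rewrite !inE andbC.
rewrite (partition_big (fun h : {perm T} => inord #|moved h| : 'I_n.+1)
  xpredT) //=.
apply: (@le_trans _ _ (\sum_(k < n.+1) n%:R ^- (M + 2))%R).
  apply: ler_sum => k _.
  rewrite (eq_bigr (fun=> ((a k)%:R^-1 * n%:R ^- (M + 2))%R)); last first.
    by move=> h /andP[_ /eqP <-]; rewrite inordK // ltnS max_card.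
  rewrite sumr_const.
  rewrite (_ : #|_| = a k); last first.
    rewrite /a; apply: eq_card => h; rewrite !inE; congr (_ && _).
    by rewrite -val_eqE /= inordK // ltnS max_card.
  rewrite -[X in (X <= _)%R]mulr_natl mulrA.
  rewrite ler_piMl ?exprn_ge0 ?invr_ge0 ?exprn_ge0 ?ler0n //.
  have [->|ak] := posnP (a k); first by rewrite mul0r.
  by rewrite mulfV // pnatr_eq0 -lt0n.
rewrite sumr_const card_ord -[X in (X <= _)%R]mulr_natr exprD invfM -mulrA ler_piMr //.
  by rewrite invr_ge0 exprn_ge0 ?ltW.
rewrite mulrC ler_pdivrMr ?exprn_gt0 // mul1r -natrX ler_nat.
by nia.
Qed.
End SmallBase.

(** * Bases from separating tuples *)

Section Hitting.
Variables (P Q : finType) (S : P -> Q -> bool) (K : nat).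
Hypothesis P_gt0 : (0 < #|P|)%N.
Hypothesis dense : forall q, (#|P| <= K * #|[set p | S p q]|)%N.

Lemma ex_dense (U : {set Q}) :
  exists p, (#|U| <= K * #|[set q in U | S p q]|)%N.
Proof.
have [p0 _] := card_gt0P P_gt0.
apply/existsP; apply: contraT; rewrite negb_exists => /forallP no_p.
have : (\sum_p K * #|[set q in U | S p q]| < \sum_(p : P) #|U|)%N.
  by apply: (@ltn_sum _ xpredT _ _ p0) => // p _; rewrite ltnNge no_p.
rewrite sum_nat_const ltnNge => /negP[].
rewrite -big_distrr /=; under eq_bigr => p _ do rewrite -sum1dep_card.
rewrite (exchange_big_dep (mem U)) /=; last by move=> p q _ /andP[].
rewrite mulnC -sum_nat_const big_distrr leq_sum //= => q Uq.
apply: leq_trans (dense q) _; rewrite leq_mul2l -sum1dep_card; apply/orP; right.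
by apply: eq_leq; apply: eq_bigl => p; rewrite Uq.
Qed.

(* Greedy choice: each new element of [s] catches at least a fraction [1/K] of the
   elements missed so far. *)
Lemma ex_hitting_aux r : exists2 s : seq P, size s = r &
  (#|[set q | ~~ has (S^~ q) s]| * K ^ r <= #|Q| * K.-1 ^ r)%N.
Proof.
elim: r => [|r [s sz_s IHs]].
  by exists [::] => //; rewrite !muln1 max_card.
set U := [set q | _] in IHs; have [p hp] := ex_dense U.
exists (p :: s); first by rewrite /= sz_s.
set V := [set q | _]; have UV : (#|U| = #|V| + #|[set q in U | S p q]|)%N.
  rewrite -(cardsID [set q | S p q] U) addnC; congr (_ + _)%N.
    by apply: eq_card => q; rewrite !inE negb_or andbC.
  by apply: eq_card => q; rewrite !inE andbC.
have KV : (K * #|V| <= K.-1 * #|U|)%N by case: (K) hp => [|k]; nia.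
rewrite !expnS; apply: (@leq_trans (K.-1 * (#|U| * K ^ r))); last first.
  by rewrite [leqRHS]mulnCA leq_mul2l IHs orbT.
by rewrite !mulnA leq_mul2r [(_ * K)%N]mulnC KV orbT.
Qed.

(** After [K * l] greedy choices at most [#|Q| * (1 - 1/K) ^ (K * l) <= #|Q| / 2 ^ l < 1] elements
    are missed, as Bernoulli's inequality gives [(1 - 1/K) ^ K <= 1/2]. *)
Lemma ex_hitting l : (0 < K)%N -> (#|Q| < 2 ^ l)%N ->
  exists2 s : seq P, size s = (K * l)%N & forall q, has (S^~ q) s.
Proof.
move=> K0 Ql; have [s sz_s hs] := ex_hitting_aux (K * l).
exists s => // q; apply: contraT => nq.
have {nq}U0 : (0 < #|[set q | ~~ has (S^~ q) s]|)%N.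
  by apply/card_gt0P; exists q; rewrite inE.
have bern m k : (k ^ m.+1 + m.+1 * k ^ m <= k.+1 ^ m.+1)%N.
  elim: m => [|m IHm]; first by rewrite !expn1 expn0; lia.
  rewrite [X in (_ <= X)%N]expnS; apply: leq_trans (leq_mul (leqnn k.+1) IHm).
  by rewrite !expnS; nia.
have : (2 * K.-1 ^ K <= K ^ K)%N.
  case: (K) K0 => // k _; apply: leq_trans (bern k k).
  by rewrite /= expnS; nia.
move=> K2; have {}K2 : (2 ^ l * K.-1 ^ (K * l) <= K ^ (K * l))%N.
  by rewrite !expnM -expnMn; case: (l) => // l'; rewrite leq_exp2r.
have K_gt0 : (0 < K ^ (K * l))%N by rewrite expn_gt0 K0.
have : (K ^ (K * l) <= #|Q| * K.-1 ^ (K * l))%N.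
  by apply: leq_trans hs; rewrite leq_pmull.
have [->|k_gt0] := posnP (K.-1 ^ (K * l))%N; first by rewrite muln0 leqNgt K_gt0.
by move/(leq_trans K2); rewrite leq_pmul2r // leqNgt Ql.
Qed.
End Hitting.

Section Separation.
Variables (T : finType) (H : {group {perm T}}).

Definition sep i (p : i.-tuple T) (x y : T) : bool :=
  [forall g in H, (map g p == p :> seq T) ==> (g x != y)].

(** [B] may repeat points: bases arise below by concatenating tuples. *)
Definition has_base b :=
  exists B : 'I_b -> T, forall h, h \in H -> (forall i, h (B i) = B i) -> h = 1.

Lemma sepPn i (p : i.-tuple T) x y :
  reflect (exists g, [/\ g \in H, map g p = p :> seq T & g x = y]) (~~ sep p x y).
Proof.
rewrite negb_forall_in; apply: (iffP exists_inP) => [[g Hg]|[g [Hg gp gx]]].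
  by rewrite negb_imply negbK => /andP[/eqP gp /eqP gx]; exists g.
by exists g; rewrite // gp gx !eqxx.
Qed.

(** By [ex_hitting] there are [K * l] tuples such that every pair of distinct points is separated by
    one of them; their entries form the base. If [h] fixes all entries, no chosen tuple separates
    [x] from [h x], so [h x = x]. *)
Lemma has_base_of_sep i K l : (0 < K)%N -> (0 < #|T|)%N ->
    (forall x y, x != y ->
       #|T| ^ i <= K * #|[set p : i.-tuple T | sep p x y]|)%N ->
    (#|T| ^ 2 < 2 ^ l)%N ->
  has_base (K * l * i).
Proof.
move=> K0 T0 dense Tl.
pose S (p : i.-tuple T) (q : T * T) := (q.1 == q.2) || sep p q.1 q.2.
have cP : #|{: i.-tuple T}| = (#|T| ^ i)%N by rewrite card_tuple.
have P0 : (0 < #|{: i.-tuple T}|)%N by rewrite cP expn_gt0 T0.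
have dS q : (#|{: i.-tuple T}| <= K * #|[set p | S p q]|)%N.
  case: q => x y; rewrite /S /= cP; case: eqP => [_|/eqP/dense //].
  by rewrite (_ : [set p | _] = setT) ?cardsT ?cP ?leq_pmull.
have Ql : (#|{: T * T}| < 2 ^ l)%N by rewrite card_prod mulnn.
have [s sz_s hit] := ex_hitting P0 dS K0 Ql.
have [p0 _] := card_gt0P P0.
pose B (q : 'I_(K * l) * 'I_i) := tnth (nth p0 s q.1) q.2.
have cJ : (K * l * i = #|{: 'I_(K * l) * 'I_i}|)%N by rewrite card_prod !card_ord.
exists (fun k => B (enum_val (cast_ord cJ k))) => h Hh fixB.
apply/permP=> x; rewrite perm1; apply: contraTeq isT => /negP hx.
have /hasP[p ps] := hit (x, h x); rewrite /S /= eq_sym => /orP[/hx //|sp].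
suff /negP[] : ~~ sep p x (h x) by [].
apply/sepPn; exists h; split=> //.
have lt_p : (index p s < K * l)%N by rewrite -sz_s index_mem.
rewrite -[RHS]map_id; apply/eq_in_map=> _ /tnthP[k ->].
have := fixB (cast_ord (esym cJ) (enum_rank (Ordinal lt_p, k))).
by rewrite cast_ordKV enum_rankK /B /= nth_index.
Qed.

End Separation.

(** * Primitive groups that are not 2-transitive *)

Section Primitive.
Variables (T : finType) (H : {group {perm T}}).
Hypothesis primH : [primitive H, on [set: T] | 'P].

Lemma primitive_trans x y : exists2 g, g \in H & g x = y.
Proof.
have [trH _] := andP primH.
by have [g Hg ->] := atransP2 trH (in_setT x) (in_setT y); exists g.
Qed.

(** The classes of [r] form an [H]-invariant partition, so primitivity leaves at most one class or
    at least [#|T|] of them. *)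
Lemma primitive_equiv (r : rel T) :
    reflexive r -> symmetric r -> transitive r ->
    (forall g x y, g \in H -> r x y -> r (g x) (g y)) ->
  (forall x y, r x y -> x = y) \/ (forall x y, r x y).
Proof.
move=> rxx rsym rtr inv; have eqr : {in [set: T] & &, equivalence_rel r}.
  move=> x y z _ _ _; split=> // rxy; apply/idP/idP; last exact: rtr.
  by apply: rtr; rewrite rsym.
pose f x := [set y | r x y].
have defQ : equivalence_partition r [set: T] = f @: [set: T].
  by apply: eq_imset => x; apply/setP=> y; rewrite !inE.
have [_ /existsPn /(_ (equivalence_partition r [set: T]))] := andP primH.
rewrite /imprimitivity_system equivalence_partitionP //= negb_and defQ.
case/orP=> [/negP[]|].
  have invf g X : g \in H -> X \in f @: [set: T] -> g @: X \in f @: [set: T].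
    move=> Hg /imsetP[x _ ->]; apply/imsetP; exists (g x) => //.
    apply/setP=> y; rewrite -(permKV g y) mem_imset ?inE; last exact: perm_inj.
    apply/idP/idP=> [/(inv g)->//|/(inv g^-1)].
    by rewrite !permK groupV => ->.
  apply/actsP=> g Hg X; apply/idP/idP=> [|/(invf g)->//].
  move/(invf g^-1); rewrite groupV => /(_ Hg).
  by rewrite -[g^-1 @: _]/(('P^*)%act _ g^-1) actK.
rewrite negb_and -!leqNgt => /orP[Q1|QT].
  right=> x y; have /card_le1_eqP/(_ _ _) := Q1.
  move=> /(_ (f x) (f y)) /(_ (imset_f f (in_setT _)) (imset_f f (in_setT _))).
  by move/setP/(_ y); rewrite !inE rxx.
left=> x y rxy; apply/eqP; apply: contraTT QT => xy; rewrite -ltnNge.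
have -> : f @: [set: T] = f @: [set~ x].
  apply/eqP; rewrite eqEsubset [X in _ && X]imsetS ?subsetT ?andbT //.
  apply/subsetP=> _ /imsetP[z _ ->]; have [->|zx] := eqVneq z x; last first.
    by apply: imset_f; rewrite !inE.
  apply/imsetP; exists y; rewrite ?inE 1?eq_sym //.
  apply/setP=> w; rewrite !inE; apply/idP/idP; last exact: rtr.
  by apply: rtr; rewrite rsym.
apply: leq_ltn_trans (leq_imset_card _ _) _.
by rewrite cardsT cardsC1 ltn_predL; apply/card_gt0P; exists x.
Qed.
End Primitive.

Section Distinguishing.
Variables (T : finType) (H : {group {perm T}}).

(** Babai's distinguishing set; the lemmas below show that its cardinality is an [H]-invariant
    pseudometric on [T]. *)
Definition dist_set (x y : T) : {set T} :=
  [set z | [forall g in H, (g z == z) ==> (g x != y)]].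

Lemma dist_setPn x y z :
  reflect (exists g, [/\ g \in H, g z = z & g x = y]) (z \notin dist_set x y).
Proof.
rewrite inE negb_forall_in; apply: (iffP exists_inP) => [[g Hg]|[g [Hg gz gx]]].
  by rewrite negb_imply negbK => /andP[/eqP gz /eqP gx]; exists g.
by exists g; rewrite // gz gx !eqxx.
Qed.

Lemma dist_set_sym x y : dist_set x y = dist_set y x.
Proof.
apply/setP=> z; apply/idP/idP; apply: contraTT => /dist_setPn[g [Hg gz gx]];
  apply/dist_setPn; exists g^-1; rewrite groupV; split=> //.
- by rewrite -{1}gz permK.
- by rewrite -{1}gx permK.
- by rewrite -{1}gz permK.
by rewrite -{1}gx permK.
Qed.

Lemma dist_set_refl x : dist_set x x = set0.
Proof.
apply/setP=> z; rewrite [RHS]inE; apply/negbTE/dist_setPn.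
by exists 1; rewrite group1 !perm1.
Qed.

Lemma dist_set_trans x y z : dist_set x z \subset dist_set x y :|: dist_set y z.
Proof.
apply/subsetP=> w; apply: contraTT; rewrite inE negb_or.
case/andP=> /dist_setPn[g [Hg gw gx]] /dist_setPn[k [Hk kw ky]].
by apply/dist_setPn; exists (g * k); rewrite groupM // !permM gw kw gx ky.
Qed.

Lemma dist_set_act g x y : g \in H -> dist_set (g x) (g y) = g @: dist_set x y.
Proof.
move=> Hg; apply/setP=> z.
rewrite -(permKV g z) mem_imset; last exact: perm_inj.
apply/idP/idP; apply: contraTT => /dist_setPn[k [Hk kz kx]]; apply/dist_setPn.
  exists (k ^ g); split; rewrite ?groupJ ?permJ ?kz ?kx //.
exists (k ^ g^-1); rewrite groupJ ?groupV //.
rewrite -{1}(permK g (g^-1 z)) -{1}(permK g x) !permJ kz kx !permK.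
by split.
Qed.

Lemma card_dist_set_act g x y : g \in H ->
  #|dist_set (g x) (g y)| = #|dist_set x y|.
Proof. by move=> Hg; rewrite dist_set_act // card_imset //; apply: perm_inj. Qed.

Lemma card_dist_set_trans x y z :
  (#|dist_set x z| <= #|dist_set x y| + #|dist_set y z|)%N.
Proof.
apply: leq_trans (subset_leq_card (dist_set_trans x y z)) _.
by have [] := leq_card_setU (dist_set x y) (dist_set y z).
Qed.

Section Geodesic.
Variable (d : nat).
Let near : rel T := fun x y => (#|dist_set x y| <= d)%N.

Lemma near_act g x y : g \in H -> near (g x) (g y) = near x y.
Proof. by move=> Hg; rewrite /near card_dist_set_act. Qed.

Lemma dist_path x p : path near x p ->
  (#|dist_set x (last x p)| <= size p * d)%N.
Proof.
elim: p x => [|y p IHp] x /=; first by rewrite dist_set_refl cards0.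
case/andP=> xy /IHp le; apply: leq_trans (card_dist_set_trans x y _) _.
by rewrite mulSn leq_add.
Qed.

(* On a shortest path [x = x_0, x_1, ..., x_k = y], each [x_i] with [i > 0]
   distinguishes [x_0] from [x_1]: an element fixing [x_i] and mapping [x_1] to
   [x_0] would shorten the path.  Hence [k <= d]. *)
Lemma card_dist_set_connect x y : connect near x y ->
  (#|dist_set x y| <= d ^ 2)%N.
Proof.
move=> cxy.
pose P k := [exists p : k.-tuple T, path near x p && (last x p == y)].
have exP : exists k, P k.
  case/connectP: cxy => p px lp; exists (size p); apply/existsP.
  by exists (in_tuple p); rewrite /= px lp /=.
case: (ex_minnP exP) => k /existsP[p0 /andP[px0 /eqP ly0]] mink.
have minp p : path near x p -> last x p = y -> (k <= size p)%N.
  by move=> px ly; apply: mink; apply/existsP; exists (in_tuple p); rewrite /= px ly /=.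
have [p [px ly up sz_p]] : exists p,
    [/\ path near x p, last x p = y, uniq (x :: p) & size p = k].
  move: ly0; case/shortenP: px0 => p px up sub ly; exists p; split=> //.
  apply/eqP; rewrite eqn_leq minp // andbT.
  by case/andP: up => _ up; rewrite -(size_tuple p0) uniq_leq_size.
rewrite -ly; apply: leq_trans (dist_path px) _; rewrite -mulnn leq_mul2r.
apply/orP; right; case: p px ly up sz_p => [//|x1 q] /= /andP[xx1 qx] ly up sz_p.
apply: leq_trans xx1; case/andP: up => xq uq.
change (size (x1 :: q) <= #|dist_set x x1|)%N.
rewrite -(card_uniqP (uq : uniq (x1 :: q))); apply/subset_leq_card/subsetP=> z zq.
apply/negPn/negP; rewrite dist_set_sym => /dist_setPn[g [Hg gz gx1]].
case/splitPl: zq qx ly sz_p => q1 q2 lq1; rewrite cat_path last_cat lq1.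
move=> /andP[q1x q2z] ly; rewrite size_cat => sz.
suff : (k <= size (map g q1 ++ q2))%N by rewrite size_cat size_map -sz ltnn.
apply: minp.
  rewrite cat_path -gx1 last_map lq1 gz q2z andbT path_map.
  by rewrite (eq_path (e' := near)) // => u v; apply: near_act.
by rewrite last_cat -gx1 last_map lq1 gz.
Qed.

End Geodesic.
End Distinguishing.

Definition two_transitive (T : finType) (H : {group {perm T}}) : Prop :=
  forall x y u v : T, x != y -> u != v ->
    exists g, [/\ g \in H, g x = u & g y = v].

(* Averages [dist_set] over all pairs.  The critical case is that of point stabilisers
   with an orbit of more than [n/2] points.  The complement [F z] of this orbit then
   has at least [sqrt n] points, for otherwise [F] composed with itself would miss a
   pair, hence all pairs outside [F], which would make [F] a congruence. *)
Lemma primitive_card_dist_set (T : finType) (H : {group {perm T}}) :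
    [primitive H, on [set: T] | 'P] -> ~ two_transitive H -> (4 <= #|T|)%N ->
  exists x y, (#|T| <= #|dist_set H x y| ^ 2)%N.
Proof.
move=> primH n2H n4; set n := #|T|.
have /card_gt0P[z0 _] : (0 < #|T|)%N by apply: leq_trans n4.
pose D := dist_set H.
have [[x y] maxD] : exists q, forall u v, (#|D u v| <= #|D q.1 q.2|)%N.
  have [|q qE] := @bigop.eq_bigmax (T * T)%type (fun q => #|D q.1 q.2|).
    by apply/card_gt0P; exists (z0, z0).
  exists q => u v; rewrite -qE.
  exact: (leq_bigmax (F := fun q : T * T => #|D q.1 q.2|) (u, v)).
move: maxD => /=; set M := #|D x y| => maxD; exists x, y; rewrite -/D -/M.
pose orb z u := [set v | z \notin D u v].
have orbM z u v : (v \in orb z u) = (z \notin D u v) by exact: in_set.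
have orbE z u v : reflect (exists g, [/\ g \in H, g z = z & g u = v])
    (v \in orb z u) by rewrite orbM; apply: dist_setPn.
(* Averaging [#|D u v|] over all pairs: among the triples with [z \in D u v], each [z] and [u]
   contribute the [n - #|orb z u|] points [v] outside the orbit of [u] under the stabiliser of
   [z]. *)
have avg c : (forall z u, c <= 2 * (n - #|orb z u|))%N -> (c <= 2 * M)%N.
  move=> hc; have n0 : (0 < n * n)%N by rewrite muln_gt0; lia.
  rewrite -(leq_pmul2l n0).
  have sum1 : (\sum_z \sum_u (n - #|orb z u|) <= n * (n * M))%N.
    apply: (@leq_trans (\sum_(z : T) \sum_(u : T) \sum_(v | z \in D u v) 1)).
      apply: leq_sum => z _; apply: leq_sum => u _.
      rewrite sum1dep_card leq_subLR /n -(cardsC (orb z u)) leq_add2l.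
      by apply/subset_leq_card/subsetP=> v; rewrite !inE negbK.
    rewrite exchange_big /=.
    under eq_bigr => u _ do rewrite (exchange_big_dep predT) //=.
    rewrite -!sum_nat_const; apply: leq_sum => u _; apply: leq_sum => v _.
    by rewrite sum1dep_card -[X in (_ <= X)%N]/M; apply: leq_trans (maxD u v);
       rewrite (eq_card (B := D u v)) // => w; rewrite !inE.
  apply: (@leq_trans (2 * (n * (n * M)))); last by nia.
  apply: leq_trans (leq_mul (leqnn 2) sum1).
  rewrite -mulnA -!sum_nat_const big_distrr /=.
  apply: leq_sum => z _; rewrite big_distrr /=; apply: leq_sum => u _.
  exact: hc.
pose big z u := (n < 2 * #|orb z u|)%N.
have orb_act g z u : g \in H -> #|orb (g z) (g u)| = #|orb z u|.
  move=> Hg; rewrite -[RHS](card_imset _ (@perm_inj _ g)); apply: eq_card => v.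
  rewrite -(permKV g v) mem_imset; last exact: perm_inj.
  by rewrite !orbM /D dist_set_act // mem_imset //; apply: perm_inj.
have orb_eq z u v : v \in orb z u -> orb z v = orb z u.
  move=> /orbE[g [Hg gz gu]]; apply/setP=> w; apply/orbE/orbE.
    by case=> k [Hk kz kv]; exists (g * k); rewrite groupM // !permM gz kz gu kv.
  case=> k [Hk kz ku]; exists (g^-1 * k); rewrite groupM ?groupV // !permM.
  by rewrite -{1}gz -gu !permK.
have bigE z u v : big z u -> big z v = (v \in orb z u).
  rewrite /big => bu; apply/idP/idP => [bv|/orb_eq -> //].
  have /set0Pn[w] : orb z u :&: orb z v != set0.
    rewrite -card_gt0; have := cardsUI (orb z u) (orb z v).
    by have := subset_leq_card (subsetT (orb z u :|: orb z v)); rewrite cardsT -/n; lia.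
  have orbxx t : t \in orb z t by apply/orbE; exists 1; rewrite group1 !perm1.
  by case/setIP=> /orb_eq wu /orb_eq wv; rewrite -wu wv orbxx.
have big_act g z u : g \in H -> big (g z) (g u) = big z u.
  by move=> Hg; rewrite /big orb_act.
have [/existsP[z1 /existsP[u1 b1]]|nobig] :=
    boolP [exists z, [exists u, big z u]]; last first.
  have /avg nM : forall z u, (n <= 2 * (n - #|orb z u|))%N.
    move=> z u; move: nobig; rewrite negb_exists => /forallP/(_ z).
    rewrite negb_exists => /forallP/(_ u); rewrite /big -leqNgt; lia.
  by rewrite expnS expn1; nia.
pose f := (n - #|orb z1 u1|)%N.
have ex_big z : exists u, big z u.
  have [g Hg <-] := primitive_trans primH z1 z.
  by exists (g u1); rewrite big_act.
have card_big z u : big z u -> #|orb z u| = (n - f)%N.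
  have [g Hg <-] := primitive_trans primH z1 z => bu.
  have := b1; rewrite -(big_act g) // (bigE _ _ _ bu) => /orb_eq <-.
  by rewrite orb_act // subKn // max_card.
have bf z u : big z u -> (2 * f < n)%N.
  by move=> bu; have := card_big _ _ bu; move: bu; rewrite /big; lia.
have fM : (f <= M)%N.
  suff : (2 * f <= 2 * M)%N by rewrite leq_pmul2l.
  apply: avg => z u; rewrite leq_mul2l /=; have [bu|] := boolP (big z u).
    by rewrite (card_big _ _ bu); lia.
  by rewrite /big -leqNgt; have := bf _ _ b1; lia.
apply: (@leq_trans (f ^ 2)); last by rewrite leq_sqr.
rewrite leqNgt; apply/negP=> f2n.
(* The big pairs make up more than half of [T * T], so some pair is big in both orders; as [H] is
   transitive on the big pairs, all of them are. *)
have big_sym z u : big z u -> big u z.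
  pose X := [set q | big q.1 q.2]; pose sw (q : T * T) := (q.2, q.1).
  have cX : (n * n < 2 * #|X|)%N.
    have -> : #|X| = (n * (n - f))%N.
      rewrite -sum_nat_const /X -sum1dep_card /=.
      rewrite -(pair_big_dep xpredT big (fun _ _ => 1%N)) /=.
      apply: eq_big => // a _; have [c bc] := ex_big a.
      rewrite -(card_big _ _ bc) sum1dep_card; apply: eq_card => v.
      by rewrite inE (bigE _ _ _ bc).
    by have := bf _ _ b1; nia.
  have /set0Pn[[a c] /setIP[]] : X :&: sw @: X != set0.
    rewrite -card_gt0; have := cardsUI X (sw @: X).
    have := subset_leq_card (subsetT (X :|: sw @: X)).
    rewrite cardsT card_prod -/n card_imset.
      lia.
    by move=> [? ?] [? ?] [-> ->].
  rewrite inE /= => bac /imsetP[[a' c'] + [eac eca]]; rewrite inE /= -eac -eca.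
  move=> bca; have [g Hg <-] := primitive_trans primH a z.
  rewrite -{1}(permKV g u) big_act // (bigE _ _ _ bac) => /orbE[k [Hk ka kc]].
  by rewrite -(permKV g u) big_act // -kc -[X in big _ X]ka big_act.
have big_act2 z u z' u' : big z u -> big z' u' ->
    exists g, [/\ g \in H, g z = z' & g u = u'].
  move=> bzu; have [g Hg <-] := primitive_trans primH z z'.
  rewrite -(big_act g) // in bzu => bzu'; move: (bzu'); rewrite (bigE _ _ _ bzu).
  case/orbE=> k [Hk kz ku]; exists (g * k).
  by rewrite groupM // !permM kz ku.
have card_small z : #|[set u | ~~ big z u]| = f.
  have [u bu] := ex_big z.
  have -> : [set u | ~~ big z u] = ~: orb z u.
    by apply/setP=> v; rewrite in_setC inE (bigE _ _ _ bu).
  by rewrite cardsCs setCK (card_big _ _ bu) subKn // leq_subr.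
(* Only [f * f < n] paths of two non-big steps start at [z1], so their ends miss some [w]. *)
have [w bw] : exists w, forall u, big z1 u || big u w.
  pose Y := [set q | ~~ big z1 q.1 && ~~ big q.1 q.2].
  have cY : #|Y| = (f * f)%N.
    rewrite -{1}(card_small z1) -sum_nat_const /Y -sum1dep_card.
    rewrite -(pair_big_dep (fun u => ~~ big z1 u) (fun u v => ~~ big u v)
      (fun _ _ => 1%N)) /=.
    apply: eq_big => u; first by rewrite inE.
    by rewrite sum1dep_card card_small.
  have : (#|snd @: Y| < #|T|)%N.
    by apply: leq_ltn_trans (leq_imset_card _ _) _; rewrite cY mulnn.
  have [wY _|allY] := boolP [exists w, w \notin snd @: Y]; last first.
    rewrite ltnNge -cardsT subset_leq_card //; apply/subsetP=> w _.
    by apply: contraNT allY => wY; apply/existsP; exists w.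
  case/existsP: wY => w wY; exists w => u.
  apply: contraR wY; rewrite negb_or => bub; apply/imsetP; exists (u, w) => //.
  by rewrite inE.
have nbig z : ~~ big z z.
  rewrite /big -leqNgt (_ : orb z z = [set z]) ?cards1; first by lia.
  apply/setP=> v; rewrite inE; apply/orbE/eqP => [[g [_ -> ->]]//|->].
  by exists 1; rewrite group1 !perm1.
have bz1w : big z1 w by have := bw z1; rewrite (negPf (nbig _)).
have no_mid a c u : big a c -> big a u || big u c.
  move=> bac; have [g [Hg <- <-]] := big_act2 _ _ _ _ bz1w bac.
  by rewrite -(permKV g u) !big_act // bw.
(* Not being big is now a congruence. If it is equality, [H] is 2-transitive; if it is the full
   relation, [bz1w] fails. *)
have := primitive_equiv primH (r := fun z u => ~~ big z u).
case=> // [z u|u z t|g z u Hg|inj_small|all_small].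
- by apply/idP/idP; apply: contra; apply: big_sym.
- by move=> zu ut; apply/negP=> /(no_mid _ _ u); rewrite (negPf zu) (negPf ut).
- by rewrite big_act.
- case: n2H => a c u v ac uv; apply: big_act2.
    by apply: contraNT ac => /inj_small ->.
  by apply: contraNT uv => /inj_small ->.
by have := all_small z1 w; rewrite bz1w.
Qed.

(** The graph joining points at distance at most [d] has the edge [x], [y], so it is connected by
    primitivity. Hence all distances are at most [d ^ 2], while some distance is at least the square
    root of [#|T|]. *)
Lemma uniprimitive_dist_set_ge (T : finType) (H : {group {perm T}}) x y :
    [primitive H, on [set: T] | 'P] -> ~ two_transitive H -> (4 <= #|T|)%N ->
  x != y -> (#|T| <= #|dist_set H x y| ^ 4)%N.
Proof.
move=> primH n2H n4 xy; set d := #|dist_set H x y|.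
pose near u v := (#|dist_set H u v| <= d)%N.
have near_sym : symmetric near by move=> u v; rewrite /near dist_set_sym.
have near_con : connect_sym near.
  exact: sym_connect_sym.
have := primitive_equiv primH (r := connect near) (@connect0 _ near) near_con
  (@connect_trans _ near).
case=> [g u v Hg /connectP[p pu ->]|small|con].
- apply/connectP; exists (map g p); rewrite ?last_map //.
  rewrite path_map; apply: sub_path pu => a b.
  by rewrite /= /near card_dist_set_act.
- by move/eqP: xy; case; apply: small; apply: connect1; rewrite /near.
have [u [v uv]] := primitive_card_dist_set primH n2H n4.
apply: leq_trans uv _; rewrite (expnM _ 2 2) leq_sqr.
by apply: card_dist_set_connect; apply: con.
Qed.

Lemma uniprimitive_base (T : finType) (H : {group {perm T}}) C l :
    [primitive H, on [set: T] | 'P] -> ~ two_transitive H -> (4 <= #|T|)%N ->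
    (0 < C)%N -> (#|T| ^ 2 < 2 ^ l)%N -> ((2 * (C * l)) ^ 4 < #|T|)%N ->
  exists b, [/\ (0 < b)%N, (C * b <= #|T|)%N & has_base H b].
Proof.
move=> primH n2H n4 C0 nl Cl; set n := #|T| in n4 nl Cl *.
have l0 : (0 < l)%N by case: (l) nl => //; rewrite expn0; nia.
have Cl0 : (0 < C * l)%N by rewrite muln_gt0 C0.
have Cln : (C * l <= n)%N.
  apply: leq_trans (ltnW Cl); apply: (@leq_trans (2 * (C * l))); first by lia.
  by rewrite -{1}[(2 * _)%N]expn1 leq_pexp2l //; lia.
(* The largest [K] with [C * (K * l) <= n]. It suffices for the density bound: distinguishing sets
   have more than [2 * C * l] points, and [n < K.+1 * (C * l) <= K * (2 * C * l)]. *)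
pose K := (n %/ (C * l))%N.
have K0 : (0 < K)%N by rewrite divn_gt0.
have nK : (n < K.+1 * (C * l))%N by apply: ltn_ceil.
exists (K * l * 1)%N; split; first by rewrite muln1 muln_gt0 K0.
  by rewrite muln1 mulnA mulnAC mulnC leq_trunc_div.
apply: has_base_of_sep => // [|x y xy]; first by apply: leq_trans n4.
rewrite expn1 -/n; have := uniprimitive_dist_set_ge primH n2H n4 xy.
move/(leq_trans Cl); rewrite ltn_exp2r // => d_gt.
apply: (@leq_trans (K * #|dist_set H x y|)); first by nia.
rewrite leq_mul2l; apply/orP; right.
have finj : injective (fun z => [tuple z] : 1.-tuple T).
  by move=> z1 z2 /(congr1 val) [].
rewrite -(card_imset _ finj); apply/subset_leq_card/subsetP.
move=> _ /imsetP[z zD ->]; rewrite inE; apply: contraLR zD.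
by case/sepPn=> g [Hg [gz] gx]; apply/dist_setPn; exists g.
Qed.

(** * Groups containing a 3-cycle *)

Section ThreeCycle.
Variables (T : finType) (H : {group {perm T}}).
Hypothesis tr2H : two_transitive H.

(** Products act from left to right, so this 3-cycle sends [a] to [c], [c] to [b] and [b] to [a]. *)
Definition cyc3 a b c :=
  [&& a != b, b != c, a != c & tperm a b * tperm b c \in H].

Lemma cyc3_rot a b c : cyc3 a b c -> cyc3 b c a.
Proof.
case/and4P=> ab bc ac Hc; apply/and4P; rewrite (eq_sym c a) (eq_sym b a); split=> //.
by move: Hc; rewrite conjgC tpermJ tpermL tpermD 1?eq_sym // [tperm c a]tpermC.
Qed.

Lemma cyc3_rev a b c : cyc3 a b c -> cyc3 c b a.
Proof.
case/and4P=> ab bc ac; rewrite -groupV invMg !tpermV => Hc.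
apply/and4P; rewrite (tpermC c b) (tpermC b a) (eq_sym c b) (eq_sym b a) (eq_sym c a).
by split.
Qed.

Lemma cyc3_act g a b c : g \in H -> cyc3 a b c -> cyc3 (g a) (g b) (g c).
Proof.
move=> Hg /and4P[ab bc ac Hc].
apply/and4P; rewrite !(inj_eq perm_inj); split=> //.
by rewrite -!tpermJ -conjMg groupJ.
Qed.

Lemma cyc3_perm a b c : cyc3 a b c -> exists s,
  [/\ s \in H, s a = c, s c = b, s b = a &
      forall x, x != a -> x != b -> x != c -> s x = x].
Proof.
case/and4P=> ab bc ac Hc; exists (tperm a b * tperm b c).
split=> // [||| x xa xb xc]; rewrite permM.
- by rewrite !tpermL.
- by rewrite (tpermD ac bc) tpermR.
- by rewrite tpermR tpermD // eq_sym.
by rewrite !tpermD // eq_sym.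
Qed.

Lemma cyc3_share2 a b c d : cyc3 a b c -> cyc3 a b d -> c != d -> cyc3 a c d.
Proof.
move=> abc abd cd; have [_ bd ad _] := and4P abd.
have [s [Hs sa sc sb fix_s]] := cyc3_perm abc.
have := cyc3_act Hs abd; rewrite sa sb fix_s 1?eq_sym //.
by move/cyc3_rev/cyc3_rot.
Qed.

(** Conjugating the first 3-cycle twice by the second replaces [x] by [z]; the result shares [y] and
    [u] with the first, and [cyc3_share2] applies. *)
Lemma cyc3_share1 x y u z w : cyc3 x y u -> cyc3 x z w ->
  uniq [:: x; y; u; z; w] -> cyc3 x y z.
Proof.
move=> xyu xzw; rewrite /= !inE !negb_or -!andbA.
case/and5P=> xy xu xz xw /and5P[yu yz yw uz /and3P[uw zw _]].
have [s [Hs sx sw _ fix_s]] := cyc3_perm xzw.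
have := cyc3_act Hs (cyc3_act Hs xyu); rewrite sx sw !fix_s // 1?eq_sym //.
move/cyc3_rot => yuz; have yux := cyc3_rot xyu.
exact: cyc3_rot (cyc3_rev (cyc3_share2 yux yuz xz)).
Qed.

Lemma cyc3_all a b c : cyc3 a b c ->
  forall x y z, x != y -> y != z -> x != z -> cyc3 x y z.
Proof.
move=> abc x y z xy yz xz; have [ab bc ac _] := and4P abc.
have ex u v : u != v -> exists w, cyc3 u v w.
  move=> uv; have [g [Hg <- <-]] := tr2H ab uv.
  by exists (g c); apply: cyc3_act.
have swap d e f : cyc3 d e f -> cyc3 d f e.
  by move/cyc3_rev/cyc3_rot/cyc3_rot.
have [u xyu] := ex _ _ xy; have [w xzw] := ex _ _ xz.
have [<-//|uz] := eqVneq u z.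
have [wy|wy] := eqVneq w y.
  by move: xzw; rewrite wy; apply: swap.
have [wu|wu] := eqVneq w u.
  rewrite {}wu in xzw.
  exact: (cyc3_share2 (swap _ _ _ xyu) (swap _ _ _ xzw) yz).
apply: (cyc3_share1 xyu xzw); have [_ yu xu _] := and4P xyu.
have [_ zw xw _] := and4P xzw.
by rewrite /= !inE !negb_or xy xu xz xw yu yz uz zw eq_sym wy eq_sym wu.
Qed.

(** An even permutation is a product of pairs of transpositions. A pair is trivial, a 3-cycle, or
    becomes a product of two such by inserting [tperm y z] twice. *)
Lemma Alt_sub_of_cyc3 a b c : cyc3 a b c -> 'Alt_T \subset H.
Proof.
move=> abc; have all3 := cyc3_all abc.
have two x y z : x != y -> y != z -> tperm x y * tperm y z \in H.
  move=> xy yz; have [<-|xz] := eqVneq x z.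
    by rewrite [tperm y x]tpermC tperm2 group1.
  by have /and4P[] := all3 x y z xy yz xz.
have pair x y z w : x != y -> z != w -> tperm x y * tperm z w \in H.
  move=> xy zw; have [zy|yz] := eqVneq z y.
    by rewrite -zy in xy *; apply: two.
  have -> : tperm x y * tperm z w = (tperm x y * tperm y z) * (tperm y z * tperm z w).
    by rewrite -mulgA (mulgA (tperm y z)) tperm2 mul1g.
  by rewrite groupM ?two // eq_sym.
apply/subsetP=> p; rewrite Alt_even; have [ts -> dts] := prod_tpermP p.
rewrite odd_perm_prod //.
have [k] := ubnP (size ts); elim: k ts dts => // k IHk [|t [|u ts]] //=.
  by rewrite big_nil group1.
rewrite negbK => /and3P[dt du dts] sz ev; rewrite !big_cons mulgA groupM ?IHk //.
  exact: pair.
by lia.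
Qed.

End ThreeCycle.

Lemma Alt_sub_eq (T : finType) (H : {group {perm T}}) : (1 < #|T|)%N ->
  'Alt_T \subset H -> H :=: 'Alt_T \/ H :=: 'Sym_T.
Proof.
move=> T1 sAH; have [->|neq] := eqVneq (H : {set _}) 'Alt_T; first by left.
right; apply/eqP; rewrite eqEcard subsetT /=.
have cS : #|'Sym_T| = (2 * #|'Alt_T|)%N by rewrite card_Alt // card_Sym.
have /dvdnP[q cq] := cardSg sAH; rewrite cS cq leq_mul2r; apply/orP; right.
case: q cq => [|[|q]] //; first by move/eqP; rewrite mul0n -leqn0 leqNgt cardG_gt0.
by rewrite mul1n => cHA; case/eqP: neq; apply/eqP; rewrite eq_sym eqEcard sAH cHA /=.
Qed.

(** By transitivity each point of [Om] is sent to each other one by the same number of elements of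
    [H]. This serves below for points and for ordered pairs of distinct points. *)
Lemma sum_act (T S : finType) (H : {group {perm T}}) (Om X Y : {set S})
    (act : {perm T} -> S -> S) :
    (forall g q, g \in H -> q \in Om -> act g q \in Om) ->
    (forall g k q, act (g * k) q = act k (act g q)) ->
    (forall q q', q \in Om -> q' \in Om -> exists2 g, g \in H & act g q = q') ->
    X \subset Om -> Y \subset Om ->
  (#|Om| * \sum_(g in H) #|[set q in X | act g q \in Y]| = #|X| * #|Y| * #|H|)%N.
Proof.
move=> actOm actM actT XOm YOm.
have fiber q y : q \in X -> y \in Y ->
    (#|[set g in H | act g q == y]| * #|Om| = #|H|)%N.
  move=> Xq Yy; apply: card_fiber => [g Hg|s s' Ss Ss'|].
  - by apply: actOm Hg _; apply: (subsetP XOm).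
  - have [a Ha as'] := actT _ _ Ss Ss'; exists a => // g _ gs.
    by rewrite actM gs.
  exact: (subsetP YOm).
under eq_bigr => g _ do rewrite -sum1dep_card.
rewrite (exchange_big_dep (mem X)) /=; last by move=> g q _ /andP[].
under eq_bigr => q Xq.
  rewrite (partition_big (act^~ q) (mem Y)) => [|g /andP[_ /andP[]]//].
  under eq_bigr => y Yy.
    rewrite (eq_bigl (fun g => (g \in H) && (act g q == y))) => [|g]; last first.
      by rewrite Xq; case: eqP => [->|]; rewrite ?andbF // (Yy : y \in Y) !andbT.
    rewrite sum1dep_card.
    over.
  over.
rewrite big_distrr /=.
under eq_bigr => q Xq.
  rewrite big_distrr /=.
  under eq_bigr => y Yy.
    rewrite mulnC fiber //.
    over.
  rewrite sum_nat_const.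
  over.
by rewrite sum_nat_const mulnA.
Qed.

(** * Bochert's bound for the minimal degree *)

Section Bochert.
Variables (T : finType) (H : {group {perm T}}).
Hypothesis tr2H : two_transitive H.
Hypothesis n_big : (60 <= #|T|)%N.
Let n := #|T|.

Lemma two_transitive_trans x y : exists2 g, g \in H & g x = y.
Proof.
have ex z : exists w : T, z != w.
  apply/existsP; apply: contraT; rewrite negb_exists => /forallP all_z.
  have : (#|[set: T]| <= #|[set z]|)%N.
    apply/subset_leq_card/subsetP=> w _; rewrite inE eq_sym.
    by have := all_z w; rewrite negbK.
  by rewrite cards1 cardsT; lia.
have [x' xx'] := ex x; have [y' yy'] := ex y.
by have [g [Hg gx _]] := tr2H xx' yy'; exists g.
Qed.

Lemma sum_act1 (X Y : {set T}) :
  (n * \sum_(g in H) #|[set a in X | g a \in Y]| = #|X| * #|Y| * #|H|)%N.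
Proof.
rewrite /n -cardsT.
apply: (@sum_act _ _ _ _ _ _ (fun (g : {perm T}) a => g a)); rewrite ?subsetT //.
- by move=> g k q; rewrite permM.
by move=> q q' _ _; apply: two_transitive_trans.
Qed.

Definition offdiag (A : {set T}) : {set T * T} :=
  [set q | [&& q.1 != q.2, q.1 \in A & q.2 \in A]].

Lemma card_offdiag A : #|offdiag A| = (#|A| * #|A|.-1)%N.
Proof.
rewrite /offdiag -sum1dep_card -sum_nat_const.
rewrite (eq_bigl (fun q => (q.1 \in A) && ((q.2 \in A) && (q.1 != q.2)))).
  rewrite -(pair_big_dep (mem A) (fun x y => (y \in A) && (x != y))
    (fun _ _ => 1%N)) /=.
  apply: eq_bigr => x Ax; rewrite sum1dep_card (cardsD1 x A) Ax.
  by apply: eq_card => y; rewrite !inE eq_sym andbC.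
by move=> q; rewrite andbC andbA.
Qed.

Let Om := offdiag setT.

Lemma sum_act2 (X Y : {set T * T}) : X \subset Om -> Y \subset Om ->
  (n * n.-1 * \sum_(g in H) #|[set q in X | (g q.1, g q.2) \in Y]|
     = #|X| * #|Y| * #|H|)%N.
Proof.
move=> XOm YOm; rewrite /n -cardsT -card_offdiag.
apply: (@sum_act _ _ _ _ _ _
  (fun (g : {perm T}) (q : T * T) => (g q.1, g q.2))) => //.
- by move=> g q _; rewrite !inE (inj_eq perm_inj).
- by move=> g k q; rewrite !permM.
move=> [a c] [u v]; rewrite !inE !andbT => ac uv.
by have [g [Hg gu gv]] := tr2H ac uv; exists g; rewrite //= gu gv.
Qed.

Variable h : {perm T}.
Hypothesis Hh : h \in H.
Let M := moved h.
Let m := #|M|.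
Let I (g : {perm T}) := #|[set a in M | g a \in M]|.

Lemma card_moved_conjI g : #|M :&: moved (h ^ g)| = I g.
Proof.
rewrite moved_conj -[RHS](card_imset _ (@perm_inj _ g)).
apply: eq_card => x; rewrite -(permKV g x) in_setI.
by rewrite !mem_imset ?inE 1?andbC //; apply: perm_inj.
Qed.

(** [I g * (I g).-1] counts the ordered pairs of distinct points of [M] that [g] maps into [M]. *)
Lemma sum_sqr_moved :
  (n * n.-1 * \sum_(g in H) I g * (I g).-1 = (m * m.-1) ^ 2 * #|H|)%N.
Proof.
have sMM : offdiag M \subset Om.
  by apply/subsetP=> q; rewrite !inE => /and3P[->].
have := sum_act2 sMM sMM; rewrite card_offdiag mulnn => <-.
congr (_ * _)%N; apply: eq_bigr => g _; rewrite -card_offdiag.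
apply: eq_card => q; rewrite !inE (inj_eq perm_inj).
by case: (q.1 == q.2) => //=; rewrite !andbA; congr (_ && _); rewrite andbAC.
Qed.

Lemma sum_exits :
  (n * n.-1 * \sum_(g in H) #|[set a in M | (g a \in M) && (g (h a) \notin M)]|
     = m * (m * (n - m)) * #|H|)%N.
Proof.
have finj : injective (fun a => (a, h a)) by move=> a c [].
pose X := [set (a, h a) | a in M].
pose Y := setX M (~: M).
have cX : #|X| = m by rewrite card_imset.
have cY : #|Y| = (m * (n - m))%N by rewrite cardsX [#|~: M|]cardsCs setCK.
have sX : X \subset Om.
  apply/subsetP=> _ /imsetP[a + ->]; rewrite mem_moved => ha.
  by rewrite !inE /= eq_sym ha.
have sY : Y \subset Om.
  apply/subsetP=> [[a c]] /setXP[/= Ma Mc]; rewrite !inE !andbT /=.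
  by apply: contraTneq Mc => <-; rewrite inE negbK.
have := sum_act2 sX sY; rewrite cX cY => <-.
congr (_ * _)%N; apply: eq_bigr => g _.
rewrite -(card_imset _ finj); apply: eq_card => q; rewrite [RHS]inE.
apply/imsetP/andP=> [[a + ->]|[/imsetP[a Ma ->]]].
  rewrite inE => /and3P[Ma ga gha]; rewrite imset_f //=.
  by rewrite in_setX /= ga inE gha.
by rewrite in_setX /= in_setC => /andP[ga gha]; exists a => //; rewrite inE Ma ga.
Qed.

Lemma sum_moved : (n * \sum_(g in H) I g = m ^ 2 * #|H|)%N.
Proof. by rewrite sum_act1 mulnn. Qed.

(** Otherwise [I g <= I g * (I g).-1] for all [g], and comparing the means of both sides contradicts
    the bound on [m]. *)
Lemma ex_single_overlap : (0 < m)%N -> (m.-1 ^ 2 < n.-1)%N ->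
  exists2 g, g \in H & #|M :&: moved (h ^ g)| = 1%N.
Proof.
move=> m0 mn; have Hgt0 := cardG_gt0 H.
have [g Hg Ig] : exists2 g, g \in H & (I g * (I g).-1 < I g)%N.
  apply/exists_inP; apply: contraT; rewrite negb_exists_in => /forall_inP no_g.
  have : (\sum_(g in H) I g <= \sum_(g in H) I g * (I g).-1)%N.
    by apply: leq_sum => g /no_g; rewrite -leqNgt.
  have nn : (0 < n * n.-1)%N by rewrite muln_gt0; lia.
  rewrite -(leq_pmul2l nn) sum_sqr_moved mulnAC sum_moved expnMn.
  rewrite -2!mulnA (leq_pmul2l (_ : 0 < m ^ 2)%N) ?expn_gt0 ?m0 //.
  by rewrite mulnC leq_pmul2r // leqNgt mn.
exists g => //; rewrite card_moved_conjI.
by case: (I g) Ig => [|[|i]] //=; nia.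
Qed.

(** Otherwise each [g] has [N g = 0] or [m <= 3 * I g], so [m * N g <= 3 * I g ^ 2] as [N g <= I g];
    the means contradict this. The point [a] will show that [h] and [h ^ g] do not commute. *)
Lemma ex_small_overlap : (7 <= m)%N -> (8 * m <= n)%N ->
  exists g a, [/\ g \in H, a \in M, g a \in M, g (h a) \notin M &
    (3 * #|M :&: moved (h ^ g)| < m)%N].
Proof.
move=> m7 mn; have Hgt0 := cardG_gt0 H.
pose N (g : {perm T}) := #|[set a in M | (g a \in M) && (g (h a) \notin M)]|.
have NI g : (N g <= I g)%N.
  by apply/subset_leq_card/subsetP=> a; rewrite !inE => /and3P[-> ->].
have [g Hg /andP[N0 I3]] : exists2 g, g \in H & (0 < N g)%N && (3 * I g < m)%N.
  apply/exists_inP; apply: contraT; rewrite negb_exists_in => /forall_inP no_g.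
  have : (m * \sum_(g in H) N g
      <= 3 * (\sum_(g in H) I g * (I g).-1 + \sum_(g in H) I g))%N.
    rewrite -big_split !big_distrr /=; apply: leq_sum => g Hg.
    have := no_g g Hg; have := NI g.
    by rewrite negb_and -leqNgt -leqNgt => NIg /orP[]; case: (I g) NIg => [|i]; nia.
  have nn : (0 < n * n.-1)%N by rewrite muln_gt0; lia.
  rewrite -(leq_pmul2l nn) mulnCA sum_exits [leqRHS]mulnCA mulnDr sum_sqr_moved.
  rewrite [X in (_ + X)%N]mulnAC sum_moved (mulnC _ n.-1).
  have -> : (m * (m * (m * (n - m)) * #|H|) = m ^ 2 * #|H| * (m * (n - m)))%N.
    by rewrite !expnS; ring.
  have -> : (3 * ((m * m.-1) ^ 2 * #|H| + n.-1 * (m ^ 2 * #|H|)) =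
     m ^ 2 * #|H| * (3 * (m.-1 ^ 2 + n.-1)))%N by rewrite expnMn; ring.
  by rewrite leq_pmul2l ?muln_gt0 ?expn_gt0; nia.
have /card_gt0P[a /setIdP[Ma /andP[ga gha]]] := N0.
by exists g, a; rewrite card_moved_conjI.
Qed.

End Bochert.

Lemma conj_fix_moved (T : finType) (k s : {perm T}) :
  (forall x, x \in moved k -> s x = x) -> k ^ s = k.
Proof.
move=> fix_s; apply/permP=> z; rewrite -(permKV s z) permJ.
set y := s^-1 z; have [ym|ym] := boolP (y \in moved k).
  have kym : k y \in moved k.
    by move: ym; rewrite !mem_moved (inj_eq perm_inj).
  by rewrite !fix_s.
have ky : k y = y by apply/eqP; move: ym; rewrite mem_moved negbK.
rewrite ky; apply/esym/eqP; apply: contraNT ym => /[dup].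
rewrite -mem_moved => /fix_s /(@perm_inj _ s) sy.
by rewrite sy mem_moved.
Qed.

(* The commutator of two permutations whose supports meet in one point is a 3-cycle. *)
Lemma cyc3_of_single_overlap (T : finType) (H : {group {perm T}}) h k :
    h \in H -> k \in H -> #|moved h :&: moved k| = 1%N ->
  exists a b c, cyc3 H a b c.
Proof.
move=> Hh Hk /eqP/cards1P[x hkx].
have mem_hk z : (z \in moved h) && (z \in moved k) = (z == x).
  by rewrite -in_setI hkx inE.
have /andP[hx kx] : (x \in moved h) && (x \in moved k) by rewrite mem_hk.
pose y := h x.
have yx : y != x by rewrite -mem_moved.
have hy : y \in moved h by rewrite mem_moved (inj_eq perm_inj).
have ky : k y = y.
  apply/eqP; rewrite -[_ == _]negbK -mem_moved.
  by have := mem_hk y; rewrite hy (negPf yx) => /= ->.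
(* Among the points moved by [k], only [x] is moved by [h]; so on them [h] acts as the transposition
   of [x] and [y]. *)
have kh : k ^ h = k ^ tperm x y.
  suff kht : k ^ (h * tperm x y) = k.
    by rewrite -[in RHS]kht -conjgM -mulgA tperm2 mulg1.
  apply: conj_fix_moved => z kz; rewrite permM.
  have [->|zx] := eqVneq z x; first by rewrite tpermR.
  have hz : h z = z.
    apply/eqP; rewrite -[_ == _]negbK -mem_moved.
    by have := mem_hk z; rewrite kz (negPf zx) andbT => ->.
  rewrite hz tpermD 1?eq_sym //.
  by apply: contraTneq kz => ->; rewrite mem_moved ky eqxx.
exists (k x), y, x; apply/and4P; split=> //.
- by rewrite -ky (inj_eq perm_inj) eq_sym.
- by rewrite -mem_moved.
suff <- : k^-1 * k ^ h = tperm (k x) y * tperm y x by rewrite groupM ?groupV ?groupJ.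
rewrite kh {1}/conjg tpermV !mulgA; congr (_ * _); last exact: tpermC.
by rewrite -[in RHS]ky -tpermJ /conjg mulgA.
Qed.

Lemma card_moved_comm (T : finType) (h k : {perm T}) :
  (#|moved (k^-1 * k ^ h)| <= 3 * #|moved h :&: moved k|)%N.
Proof.
set P := moved h :&: moved k.
have sub : moved (k^-1 * k ^ h) \subset P :|: h @: P :|: k @: P.
  have fixed (p : {perm T}) u : u \notin moved p -> p u = u /\ p^-1 u = u.
    by rewrite mem_moved negbK => /eqP pu; rewrite -{3}pu permK.
  have memP u : (u \in P) = (u \in moved h) && (u \in moved k) by rewrite inE.
  have moved_inv (p : {perm T}) u : u \in moved p -> p^-1 u \in moved p.
    by rewrite !mem_moved permKV; apply: contra => /eqP up; rewrite {1}up permKV.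
  apply/subsetP=> z; apply: contraTT; rewrite !in_setU !negb_or.
  case/andP=> /andP[zP zhP] zkP; rewrite mem_moved negbK.
  have hzP : h^-1 z \notin P.
    by apply: contra zhP => /(imset_f h); rewrite permKV.
  have kzP : k^-1 z \notin P.
    by apply: contra zkP => /(imset_f k); rewrite permKV.
  rewrite /conjg !permM; have [zk|/fixed[kz ->]] := boolP (z \in moved k).
    have /fixed[hz _] : z \notin moved h.
      by apply: contra zP => zh; rewrite memP zh.
    have /fixed[_ ->] : k^-1 z \notin moved h.
      by apply: contra kzP => kzh; rewrite memP kzh moved_inv.
    by rewrite permKV hz.
  have [zh|/fixed[hz ->]] := boolP (z \in moved h); last by rewrite kz hz.
  have /fixed[-> _] : h^-1 z \notin moved k.
    by apply: contra hzP => kzh; rewrite memP kzh moved_inv.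
  by rewrite permKV.
have [le1 _] := leq_card_setU (P :|: h @: P) (k @: P).
have [le2 _] := leq_card_setU P (h @: P).
apply: leq_trans (subset_leq_card sub) _; apply: leq_trans le1 _.
rewrite (card_imset (mem P) (@perm_inj _ k)).
rewrite (card_imset (mem P) (@perm_inj _ h)) in le2.
by rewrite 2!mulSn mul1n addnA leq_add2r.
Qed.

(** Let [k] move the fewest points. If these are fewer than about the square root of [n],
    [ex_single_overlap] yields a 3-cycle. If they are at most [n / 8], the commutator of [k] with a
    conjugate from [ex_small_overlap] moves fewer points, so it is trivial, which the point [a]
    excludes. *)
Lemma two_transitive_moved_gt (T : finType) (H : {group {perm T}}) h :
    two_transitive H -> (60 <= #|T|)%N -> ~~ ('Alt_T \subset H) ->
    h \in H -> h != 1 ->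
  (#|T| < 8 * #|moved h|)%N.
Proof.
move=> tr2H n60 notA Hh h1.
case: (@arg_minnP _ h [pred g in H | g != 1] (fun g => #|moved g|)).
  by rewrite /= Hh.
move=> k /andP[Hk k1] mink; apply: (@leq_trans (8 * #|moved k|)); last first.
  by rewrite leq_mul2l mink //= Hh.
have m0 : (0 < #|moved k|)%N by rewrite card_gt0 moved_eq0.
have mge : (#|T|.-1 <= #|moved k|.-1 ^ 2)%N.
  rewrite leqNgt; apply: contra notA => mn.
  have [g Hg ov] := ex_single_overlap tr2H n60 Hk m0 mn.
  have [|a [b [c abc]]] := cyc3_of_single_overlap Hk _ ov; first by rewrite groupJ.
  exact: Alt_sub_of_cyc3 abc.
rewrite ltnNge; apply/negP=> m8.
have m7 : (7 <= #|moved k|)%N by move: mge; rewrite expnS expn1; nia.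
have [g [a [Hg Ma ga gka ov]]] := ex_small_overlap tr2H n60 Hk m7 m8.
pose w := (k ^ g)^-1 * (k ^ g) ^ k.
have Hw : w \in H by rewrite groupM ?groupV ?groupJ.
have [w1|w1] := eqVneq w 1; last first.
  have := mink w; rewrite /= Hw w1 => /(_ isT).
  by have := leq_ltn_trans (card_moved_comm k (k ^ g)) ov; rewrite -/w ltnNge => /negP.
have com : (k ^ g) ^ k = k ^ g by apply/esym/eqP; rewrite eq_mulVg1 -/w w1.
(* Since [k] fixes [g (k a)], both [k (g a)] and [g a] have image [g (k a)] under [k ^ g]; so [k]
   would fix [g a]. *)
have e1 : (k ^ g) (k (g a)) = k (g (k a)) by rewrite -{1}com permJ permJ.
have e2 : k (g (k a)) = g (k a) by apply/eqP; move: gka; rewrite mem_moved negbK.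
move: e1; rewrite e2 -(permJ k g a) => /perm_inj kga.
by move: ga; rewrite mem_moved kga eqxx.
Qed.

(** * Element orders in groups of large minimal degree *)

Lemma card_porbit_dvd_order (T : finType) (h : {perm T}) x :
  (#|porbit h x| %| #[h])%N.
Proof. by rewrite porbitE dvdn_orbit. Qed.

Lemma permX_fix (T : finType) (h : {perm T}) x e :
  (#|porbit h x| %| e)%N -> (h ^+ e) x = x.
Proof.
have hx : (h ^+ #|porbit h x|) x = x by rewrite permX iter_porbit.
case/dvdnP=> k ->; rewrite mulnC expgM.
elim: k => [|k IHk]; first by rewrite expg0 perm1.
by rewrite expgS permM hx.
Qed.

Lemma logn_prod_gt0 (T : finType) (F : T -> nat) p : (forall x, 0 < F x)%N ->
  logn p (\prod_x F x) = (\sum_x logn p (F x))%N.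
Proof.
move=> F0; pose R a s := (0 < a)%N /\ logn p a = s.
suff [] : R (\prod_x F x)%N (\sum_x logn p (F x))%N by [].
apply: (big_ind2 R) => [|a s b t [a0 <-] [b0 <-]|x _]; rewrite /R ?logn1 //.
by rewrite muln_gt0 a0 lognM.
Qed.

(* If [p] divides [#[h]], the points moved by [h ^+ (#[h] %/ p)] are those whose cycle
   length has the same [p]-part as [#[h]]; so [#[h] ^ n] divides the 8th power of the
   product of the cycle lengths, taken over all points. *)
Lemma order_le_of_moved_gt (T : finType) (H : {group {perm T}}) (h : {perm T}) :
    (0 < #|T|)%N ->
    (forall g, g \in H -> g != 1 -> (#|T| < 8 * #|moved g|)%N) -> h \in H ->
  (#[h] <= #|T| ^ 8)%N.
Proof.
move=> T0 bigm Hh; set n := #|T| in T0 bigm *.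
pose P := (\prod_(x : T) #|porbit h x|)%N.
have l0 x : (0 < #|porbit h x|)%N by apply/card_gt0P; exists x; apply: porbit_id.
have P0 : (0 < P)%N by apply: prodn_gt0.
have Pn : (P <= n ^ n)%N.
  by rewrite -prod_nat_const; apply: leq_prod => x _; apply: max_card.
have : (#[h] ^ n %| P ^ 8)%N.
  apply/dvdn_partP=> [|p]; first by rewrite expn_gt0 order_gt0.
  rewrite mem_primes => /andP[pp /andP[_ pdvd]].
  have {}pdvd : (p %| #[h])%N by move: pdvd; rewrite Euclid_dvdX // => /andP[].
  rewrite p_part pfactor_dvdn ?expn_gt0 ?P0 // !lognX.
  pose g := h ^+ (#[h] %/ p).
  have g1 : g != 1.
    rewrite -order_dvdn; apply/negP=> /dvdn_leq.
    rewrite divn_gt0 ?prime_gt0 // dvdn_leq // => /(_ isT).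
    by rewrite leqNgt ltn_Pdiv ?prime_gt1.
  have := bigm _ (groupX _ Hh) g1; rewrite -/g => gn.
  have mg x : x \in moved g -> (logn p #[h] <= logn p #|porbit h x|)%N.
    rewrite mem_moved; apply: contraR; rewrite -ltnNge => lt_p.
    apply/eqP/permX_fix.
    have [k hk] := dvdnP (card_porbit_dvd_order h x).
    have k0 : (0 < k)%N by case: k hk => // hk; have := order_gt0 h; rewrite hk.
    have pk : (p %| k)%N.
      move: lt_p; rewrite hk lognM // -{1}[logn p #|_|]add0n ltn_add2r.
      by rewrite logn_gt0 mem_primes => /and3P[].
    case/dvdnP: pk hk => q -> ->; rewrite mulnAC mulnK ?prime_gt0 //.
    exact: dvdn_mull.
  have : (#|moved g| * logn p #[h] <= logn p P)%N.
    rewrite /P logn_prod_gt0 //.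
    rewrite (bigID (mem (moved g))) /=; apply: leq_trans (leq_addr _ _).
    by rewrite -sum_nat_const; apply: leq_sum.
  by nia.
move/dvdn_leq; rewrite expn_gt0 P0 => /(_ isT) le.
rewrite -(leq_exp2r _ _ T0) -/n; apply: leq_trans le _.
by rewrite expnAC leq_exp2r.
Qed.

(** * Orbits on tuples *)

Section NearTransitivity.
Variables (T : finType) (H : {group {perm T}}).
Let n := #|T|.

Definition same_orbit i (u v : i.-tuple T) : bool :=
  [exists g in H, map g u == v :> seq T].

(* Divided by [n ^ (2 * i)] and [n ^ (i + 2)] respectively, the next two quantities are
   the probability that two random [i]-tuples are in the same orbit, and that a random
   [i]-tuple separates two random points. *)
Definition orbit_pairs i : nat :=
  \sum_(u : i.-tuple T) \sum_(v : i.-tuple T) same_orbit u v.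

Definition sep_triples i : nat :=
  \sum_(u : i.-tuple T) \sum_x \sum_y sep H u x y.

Lemma sum_tupleS i (F : i.+1.-tuple T -> nat) :
  (\sum_w F w = \sum_x \sum_(u : i.-tuple T) F [tuple of x :: u])%N.
Proof.
rewrite pair_bigA /=.
rewrite (reindex (fun p : T * i.-tuple T => [tuple of p.1 :: p.2])) //=.
exists (fun w => (thead w, [tuple of behead w])) => [[x u] _|w _] /=.
  by congr (_, _); apply: val_inj.
by rewrite [RHS]tuple_eta; apply: val_inj.
Qed.

Lemma same_orbitP i (u v : i.-tuple T) :
  reflect (exists2 g, g \in H & map g u = v :> seq T) (same_orbit u v).
Proof.
by apply: (iffP exists_inP) => -[g Hg guv]; exists g => //; apply/eqP.
Qed.

(** Let [g0] map [u] to [v]. If [u] does not separate [x] from [y], some [g] fixing [u] takes [x] to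
    [y], and [g * g0] maps [x :: u] to [g0 y :: v]. *)
Lemma same_orbit_step i (u v : i.-tuple T) :
  (n ^ 2 * same_orbit u v <=
     \sum_x \sum_y same_orbit [tuple of x :: u] [tuple of y :: v]
       + \sum_x \sum_y sep H u x y)%N.
Proof.
have [|] := boolP (same_orbit u v); last by rewrite muln0.
case/same_orbitP=> g0 Hg0 g0uv; rewrite muln1 -mulnn -big_split /=.
rewrite -sum_nat_const; apply: leq_sum => x _.
rewrite (reindex_inj (@perm_inj _ g0)) -big_split /= -[n]sum1_card.
apply: leq_sum => y _.
have [|/sepPn[g [Hg gu gx]]] := boolP (sep H u x y); first by rewrite addn1.
rewrite addn0 lt0b; apply/same_orbitP; exists (g * g0); first by rewrite groupM.
rewrite /= permM gx -g0uv -[in RHS]gu -map_comp; congr (_ :: _).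
by apply: eq_map => z /=; rewrite permM.
Qed.

Lemma orbit_pairs_step i :
  (n ^ 2 * orbit_pairs i <= orbit_pairs i.+1 + n ^ i * sep_triples i)%N.
Proof.
have -> : (orbit_pairs i.+1 = \sum_(u : i.-tuple T) \sum_(v : i.-tuple T)
    \sum_x \sum_y same_orbit [tuple of x :: u] [tuple of y :: v])%N.
  rewrite /orbit_pairs sum_tupleS exchange_big /=; apply: eq_bigr => u _.
  under eq_bigr => x _ do rewrite sum_tupleS exchange_big /=.
  by rewrite exchange_big.
have -> : (n ^ i * sep_triples i = \sum_(u : i.-tuple T) \sum_(v : i.-tuple T)
    \sum_x \sum_y sep H u x y)%N.
  rewrite /sep_triples big_distrr /=; apply: eq_bigr => u _.
  by rewrite sum_nat_const card_tuple.
rewrite -big_split big_distrr /=; apply: leq_sum => u _.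
rewrite -big_split big_distrr /=; apply: leq_sum => v _.
exact: same_orbit_step.
Qed.

(** The same-orbit probability is 1 for empty tuples, and each of the [j] extensions lowers it by at
    most the separation probability, which is at most [1 / (4 * j)]. *)
Lemma orbit_pairs_ge j :
    (forall i, i < j -> 4 * j * sep_triples i <= n ^ i.+2)%N ->
  (3 * n ^ (j + j) <= 4 * orbit_pairs j)%N.
Proof.
move=> few; have [->|j0] := posnP j.
  rewrite /orbit_pairs (big_pred1 [tuple]) => [|u]; last first.
    by rewrite [u]tuple0 !inE eqxx.
  rewrite (big_pred1 [tuple]) => [|u]; last by rewrite [u]tuple0 !inE eqxx.
  by rewrite (introT (same_orbitP _ _)) //; exists 1.
suff le i : (i <= j)%N ->
    ((4 * j - i) * n ^ (i + i) <= 4 * j * orbit_pairs i)%N.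
  have := le j (leqnn j).
  rewrite (_ : 4 * j - j = j * 3)%N ?[(4 * j)%N]mulnC; last by lia.
  by rewrite -!mulnA leq_pmul2l.
elim: i => [_|i IHi ij].
  rewrite subn0 muln1 leq_pmulr // /orbit_pairs.
  rewrite (big_pred1 [tuple]) => [|u]; last by rewrite [u]tuple0 !inE eqxx.
  rewrite (big_pred1 [tuple]) => [|u]; last by rewrite [u]tuple0 !inE eqxx.
  by rewrite lt0b; apply/same_orbitP; exists 1.
have step := orbit_pairs_step i; have {}IHi := IHi (ltnW ij).
have fewi := few i ij.
have e1 : (n ^ (i.+1 + i.+1) = n ^ 2 * n ^ (i + i))%N.
  by rewrite -expnD; congr (n ^ _)%N; lia.
have e2 : (n ^ i * n ^ i.+2 = n ^ 2 * n ^ (i + i))%N.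
  by rewrite -!expnD; congr (n ^ _)%N; lia.
have l1 : (n ^ i * (4 * j * sep_triples i) <= n ^ 2 * n ^ (i + i))%N.
  by rewrite -e2 leq_mul2l fewi orbT.
have l2 : (n ^ 2 * ((4 * j - i) * n ^ (i + i)) <=
    n ^ 2 * (4 * j * orbit_pairs i))%N by rewrite leq_mul2l IHi orbT.
rewrite e1 (_ : 4 * j - i.+1 = (4 * j - i).-1)%N; last by lia.
have : (0 < 4 * j - i)%N by lia.
move: l1 l2 step; move: (n ^ i)%N (n ^ (i + i))%N (n ^ 2)%N (4 * j - i)%N (4 * j)%N.
move=> a b c d e l1 l2 step d0.
have l3 : (e * (c * orbit_pairs i) <= e * (orbit_pairs i.+1 + a * sep_triples i))%N.
  by rewrite leq_mul2l step orbT.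
case: d l2 d0 => // d; nia.
Qed.

Lemma sep_triples_le i c :
    two_transitive H ->
    (forall x y, x != y -> #|[set p : i.-tuple T | sep H p x y]| <= c)%N ->
  (sep_triples i <= n ^ 2 * c)%N.
Proof.
move=> tr2H hc; rewrite /sep_triples exchange_big /= -mulnn -mulnA.
rewrite -!sum_nat_const; apply: leq_sum => x _.
rewrite exchange_big /=; apply: leq_sum => y _.
rewrite -big_mkcond sum1dep_card; have [<-|] := eqVneq x y; last exact: hc.
rewrite (_ : [set _ | _] = set0) ?cards0 //; apply/setP=> p; rewrite !inE.
apply/negbTE/sepPn; exists 1; rewrite group1 perm1; split=> //.
by rewrite -[RHS]map_id; apply: eq_map => z; rewrite perm1.
Qed.

Lemma card_sep_act i g x y : g \in H ->
  (#|[set p : i.-tuple T | sep H p x y]|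
     <= #|[set p : i.-tuple T | sep H p (g x) (g y)]|)%N.
Proof.
move=> Hg; have finj : injective (fun p : i.-tuple T => [tuple of map g p]).
  move=> p q /(congr1 val) /= /inj_map pq; apply: val_inj.
  exact: pq (@perm_inj _ g).
rewrite -(card_imset _ finj); apply/subset_leq_card/subsetP.
move=> _ /imsetP[p + ->]; rewrite !inE; apply: contraTT => /sepPn[k [Hk kp kx]].
apply/sepPn; exists (k ^ g^-1); rewrite groupJ ?groupV //.
have conjE z : (k ^ g^-1) z = g^-1 (k (g z)).
  by rewrite -{1}(permK g z) permJ.
rewrite conjE kx permK; split=> //; move: kp; rewrite /= -map_comp => kp.
apply: (inj_map (@perm_inj _ g)); rewrite -kp -map_comp.
by apply: eq_map => z /=; rewrite conjE permKV.
Qed.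

Lemma ex_dense_orbit j : (3 * n ^ (j + j) <= 4 * orbit_pairs j)%N -> (0 < n)%N ->
  exists u : j.-tuple T, (3 * n ^ j <= 4 * #|[set v | same_orbit u v]|)%N.
Proof.
move=> Qj n0; apply/existsP; apply: contraT; rewrite negb_exists => /forallP no_u.
have [x0 _] := card_gt0P n0.
have : (\sum_(u : j.-tuple T) 4 * #|[set v | same_orbit u v]|
          < \sum_(u : j.-tuple T) 3 * n ^ j)%N.
  apply: (@ltn_sum _ xpredT _ _ [tuple of nseq j x0]) => // u _.
  by rewrite ltnNge no_u.
rewrite sum_nat_const card_tuple mulnCA -expnD ltnNge => /negP[].
rewrite -big_distrr /=; apply: leq_trans Qj _; rewrite leq_mul2l /=.
apply: leq_sum => u _.
by rewrite -big_mkcond sum1dep_card.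
Qed.

(** Birthday bound: a random [j]-tuple has a repetition with probability at most [j ^ 2 / n]. *)
Lemma ffact_ge j : (n ^ j * (n - j ^ 2) <= n * n ^_ j)%N.
Proof.
elim: j => [|j IHj]; first by rewrite ffactn0 mul1n muln1 subn0.
rewrite ffactnSr expnS.
have [nj|nj] := leqP n (j.+1 ^ 2); first by move/eqP: nj => ->; rewrite muln0.
have : (n ^ j * (n - j ^ 2) * (n - j) <= n * n ^_ j * (n - j))%N.
  by rewrite leq_mul2r IHj orbT.
rewrite -[leqRHS]mulnA; apply: leq_trans.
rewrite [X in (X * _ <= _)%N]mulnC -!mulnA leq_mul2l; apply/orP; right.
by move: nj; rewrite -!mulnn; nia.
Qed.

(* The large orbit, its image under the place permutation [pi], and the set of tuples
   without repetition have densities adding up to more than 2, so they intersect. *)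
Lemma ex_perm_induced j (pi : {perm 'I_j}) :
    (3 * n ^ (j + j) <= 4 * orbit_pairs j)%N -> (2 * j ^ 2 < n)%N ->
  exists2 h, h \in H & (#[pi] %| #[h])%N.
Proof.
move=> Qj jn; have n0 : (0 < n)%N by lia.
have [u Ou] := ex_dense_orbit Qj n0.
pose O := [set v | same_orbit u v].
pose twist (v : j.-tuple T) := [tuple tnth v (pi k) | k < j].
have tinj : injective twist.
  move=> v w /eqP; rewrite eqEtuple => /forallP vw; apply: eq_from_tnth => k.
  by have := eqP (vw (pi^-1 k)); rewrite !tnth_mktuple permKV.
have cO' : #|twist @^-1: O| = #|O|.
  apply: on_card_preimset; apply: onW_bij; exact: injF_bij.
pose D := [set v : j.-tuple T | all predT v & uniq v].
have cD : (n ^ j < 2 * #|D|)%N.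
  have -> : #|D| = n ^_ j by exact: card_uniq_tuples.
  have := ffact_ge j; have : (0 < n ^ j)%N by rewrite expn_gt0 n0.
  by nia.
have call (A : {set j.-tuple T}) : (#|A| <= n ^ j)%N by rewrite -card_tuple max_card.
have : (0 < #|O :&: twist @^-1: O :&: D|)%N.
  have := cardsUI (O :&: twist @^-1: O) D; have := cardsUI O (twist @^-1: O).
  have := call (O :|: twist @^-1: O); have := call (O :&: twist @^-1: O :|: D).
  move: cD Ou; rewrite cO' -/O.
  move: #|_ :&: D| #|_ :|: D| #|O :|: _| #|O :&: _| #|D| #|O| (n ^ j)%N.
  by lia.
case/card_gt0P=> v; rewrite !inE => /andP[/andP[/same_orbitP[g Hg guv]]].
case/same_orbitP=> k Hk kuv /andP[_ uv].
(* Both [v] and its twist are images of [u], so [h] permutes the distinct entries of [v] as [pi]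
   permutes their places. *)
pose h := g^-1 * k; exists h; first by rewrite groupM ?groupV.
have hv : map h v = twist v.
  rewrite -kuv -guv -map_comp; apply: eq_map => z /=.
  by rewrite permM permK.
have hvk i : h (tnth v i) = tnth v (pi i).
  have : [tuple of map h v] = twist v by apply: val_inj.
  by move/(congr1 (fun t => tnth t i)); rewrite tnth_map tnth_mktuple.
have hX e i : (h ^+ e) (tnth v i) = tnth v ((pi ^+ e) i).
  elim: e i => [|e IHe] i; first by rewrite !expg0 !perm1.
  by rewrite !expgS [LHS]permM hvk IHe permM.
rewrite order_dvdn; apply/eqP/permP=> i; rewrite perm1.
have /tuple_uniqP injv := uv; apply: injv.
by rewrite -hX expg_order perm1.
Qed.

(** By 2-transitivity all pairs of distinct points are separated by equally many [i]-tuples, so a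
    mean above [1 / (4 * j)] gives the density needed for a base. If no [i < j] has such a mean,
    [orbit_pairs_ge] provides the large orbit. *)
Lemma two_transitive_dichotomy j l :
    two_transitive H -> (1 < n)%N -> (2 * j ^ 2 < n)%N -> (n ^ 2 < 2 ^ l)%N ->
  (exists2 i, (0 < i < j)%N & has_base H (4 * j * l * i)) \/
  (forall pi : {perm 'I_j}, exists2 h, h \in H & (#[pi] %| #[h])%N).
Proof.
move=> tr2H n1 jn nl.
have [|few] := boolP [exists i : 'I_j, (n ^ i.+2 < 4 * j * sep_triples i)%N].
  case/existsP=> i many; left; exists i.
    (* The empty tuple separates no two distinct points. *)
    rewrite ltn_ord andbT lt0n; apply/negP=> /eqP i0.
    suff : (sep_triples i <= n ^ 2 * 0)%N by move: many; nia.
    apply: sep_triples_le => // x y xy; rewrite leqn0 cards_eq0.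
    apply/eqP/setP=> p; rewrite !inE; apply/negbTE/sepPn.
    have yx : y != x by rewrite eq_sym.
    have [g [Hg gx _]] := tr2H _ _ _ _ xy yx; exists g; split=> //.
    have sp : size p = 0%N by rewrite size_tuple.
    by rewrite (size0nil sp).
  have j0 : (0 < 4 * j)%N by have := ltn_ord i; lia.
  apply: has_base_of_sep => // [|x y xy]; first exact: ltnW.
  rewrite -/n; set c := #|_|.
  have Sc : (sep_triples i <= n ^ 2 * c)%N.
    apply: sep_triples_le => // u v uv.
    have [g [Hg gu gv]] := tr2H _ _ _ _ uv xy.
    by have := card_sep_act i u v Hg; rewrite gu gv.
  have n2 : (0 < n ^ 2)%N by rewrite expn_gt0 ltnW.
  rewrite -(leq_pmul2l n2) -expnD; apply: leq_trans (ltnW many) _.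
  by rewrite mulnCA leq_mul2l Sc orbT.
right=> pi; apply: ex_perm_induced jn; apply: orbit_pairs_ge => i ij.
move: few; rewrite negb_exists => /forallP/(_ (Ordinal ij)).
by rewrite -leqNgt.
Qed.

End NearTransitivity.

(** * Permutations of large order *)

Section HighOrder.
Variables (r L : nat).
Hypothesis rL : (r`! %| L)%N.

Let q (a : nat) := (a.+1 * L).+1.
Let N := (r * L)%N.
Let J : finType := ('I_r * 'I_N.+1)%type.

(* Goedel's beta function trick. *)
Lemma coprime_cycle_lengths a b : (a < b < r)%N -> coprime (q a) (q b).
Proof.
case/andP=> ab br; rewrite /coprime; apply: contraT => d1.
have d_gt1 : (1 < gcdn (q a) (q b))%N by rewrite ltn_neqAle eq_sym d1 gcdn_gt0.
pose p := pdiv (gcdn (q a) (q b)); have pp : prime p := pdiv_prime d_gt1.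
have [pa pb] : (p %| q a)%N /\ (p %| q b)%N.
  by split; apply: dvdn_trans (pdiv_dvd _) _; rewrite ?dvdn_gcdl ?dvdn_gcdr.
have pL : (p %| L)%N.
  have : (p %| (b - a) * L)%N.
    rewrite (_ : (b - a) * L = q b - q a)%N ?dvdn_sub //.
    by rewrite /q subSS -mulnBl subSS.
  rewrite Euclid_dvdM // => /orP[/dvdn_leq le|//].
  by apply: dvdn_trans rL; rewrite dvdn_fact // prime_gt0 //; lia.
move: pa; rewrite /q -addn1 dvdn_addr ?dvdn_mull // dvdn1 => /eqP p1.
by rewrite p1 in pp.
Qed.

(** In row [a] the first [q a] points form a cycle and the others are fixed; the common row length
    [N.+1] has room for every [q a]. *)
Let shift (x : J) : J :=
  (x.1, if (x.2 < q x.1)%N then inord (x.2.+1 %% q x.1) else x.2).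

Lemma q_le (a : 'I_r) : (q a <= N.+1)%N.
Proof. by rewrite ltnS leq_mul2r ltn_ord orbT. Qed.

Lemma shift_inj : injective shift.
Proof.
move=> [a x] [b y] [<-{b}] /=; have qa : (q a <= N.+1)%N := q_le a.
have mod_lt z : (z.+1 %% q a < N.+1)%N by apply: leq_trans qa; rewrite ltn_mod.
have [xq|xq] := ltnP x (q a); have [yq|yq] := ltnP y (q a).
- move/(congr1 val); rewrite /= !inordK // => xy; congr (_, _); apply: val_inj.
  move: xy => /=; have [x1|x1] := eqVneq x.+1 (q a).
    have [y1|y1] := eqVneq y.+1 (q a); first by move=> _; lia.
    by rewrite x1 modnn modn_small //; lia.
  have [y1|y1] := eqVneq y.+1 (q a).
    by rewrite y1 modnn modn_small //; lia.
  by rewrite !modn_small //; lia.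
- by move=> xy; move: yq; rewrite -xy inordK // leqNgt ltn_mod.
- by move=> xy; move: xq; rewrite xy inordK // leqNgt ltn_mod.
by move=> ->.
Qed.

Lemma cycle_length_dvd_order (a : 'I_r) : (q a %| #[perm shift_inj])%N.
Proof.
have orb e : (perm shift_inj ^+ e) (a, ord0) = (a, inord (e %% q a)).
  elim: e => [|e IHe].
    by rewrite expg0 perm1 mod0n; congr (_, _); apply: val_inj; rewrite /= inordK.
  have mod_lt z : (z %% q a < N.+1)%N by apply: leq_trans (q_le a); rewrite ltn_mod.
  rewrite expgSr permM IHe permE /shift /= inordK // ltn_mod /=.
  by congr (_, inord _); rewrite -addn1 modnDml addn1.
have := orb #[perm shift_inj]; rewrite expg_order perm1 => -[/(congr1 val)] /=.
rewrite inordK => [/esym/eqP //|].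
by apply: leq_trans (q_le a); rewrite ltn_mod.
Qed.

(** The order is divisible by [r] pairwise coprime cycle lengths, each larger than [L]; thus it
    grows as [L ^ r] while the degree is only linear in [L]. *)
Lemma ex_perm_order_ge :
  exists pi : {perm 'I_(r * (r * L).+1)}, (L ^ r <= #[pi])%N.
Proof.
have le : (L ^ r <= #[perm shift_inj])%N.
  have : (\prod_(a < r) q a %| #[perm shift_inj])%N.
    have : forall k, (k <= r)%N -> (\prod_(0 <= a < k) q a %| #[perm shift_inj])%N.
      elim=> [|k IHk] kr; first by rewrite big_nil dvd1n.
      rewrite big_nat_recr //= Gauss_dvd ?IHk ?(ltnW kr) //.
        exact: (cycle_length_dvd_order (Ordinal kr)).
      rewrite big_nat; apply: (big_ind (fun m => coprime m (q k))).
      - exact: coprime1n.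
      - by move=> s t cs ct; rewrite coprimeMl cs.
      by move=> a /= ak; apply: coprime_cycle_lengths; rewrite ak kr.
    by move=> /(_ r (leqnn r)); rewrite big_mkord.
  move/dvdn_leq; rewrite order_gt0 => /(_ isT); apply: leq_trans.
  rewrite -[X in (L ^ X)%N]card_ord -prod_nat_const.
  by apply: leq_prod => a _; rewrite /q; nia.
have cJ : (r * N.+1 = #|J|)%N by rewrite card_prod !card_ord.
pose f (k : 'I_(r * N.+1)) : 'I_(r * N.+1) :=
  cast_ord (esym cJ) (enum_rank (perm shift_inj (enum_val (cast_ord cJ k)))).
have finj : injective f.
  move=> k1 k2 /cast_ord_inj /enum_rank_inj /perm_inj /enum_val_inj.
  exact: cast_ord_inj.
exists (perm finj); apply: leq_trans le _; apply: dvdn_leq (order_gt0 _) _.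
have fX e k : (perm finj ^+ e) k = cast_ord (esym cJ)
    (enum_rank ((perm shift_inj ^+ e) (enum_val (cast_ord cJ k)))).
  elim: e => [|e IHe]; first by rewrite !expg0 !perm1 enum_valK cast_ordK.
  by rewrite !expgSr [LHS]permM IHe permE /f cast_ordKV enum_rankK permM.
rewrite order_dvdn; apply/eqP/permP=> x; rewrite perm1.
have := fX #[perm finj] (cast_ord (esym cJ) (enum_rank x)).
rewrite expg_order perm1 cast_ordKV enum_rankK => /cast_ord_inj/enum_rank_inj.
by move <-.
Qed.

End HighOrder.

(** * Small bases of primitive groups *)

Lemma exp2_dominates A : exists E, forall e, (E <= e)%N ->
  (A * e.+1 ^ 4 < 2 ^ (e./2))%N.
Proof.
exists (4 * (A * 16 ^ 4)).+4 => e Ee.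
(* The fourth power of this bound costs only about [2 ^ (e / 4)]; the rest of [2 ^ (e / 2)] absorbs
   the constants. *)
have e1 : (e.+1 <= 16 * 2 ^ (e %/ 16))%N.
  apply: (@leq_trans (16 * (e %/ 16).+1)); first by rewrite mulnC ltn_ceil.
  by rewrite leq_mul2l ltn_expl.
apply: (@leq_ltn_trans (A * (16 * 2 ^ (e %/ 16)) ^ 4)).
  by rewrite leq_mul2l leq_exp2r // e1 orbT.
rewrite expnMn -expnM mulnA.
have A1 : (A * 16 ^ 4 < 2 ^ (A * 16 ^ 4))%N by rewrite ltn_expl.
apply: (@leq_trans (2 ^ (A * 16 ^ 4) * 2 ^ (e %/ 16 * 4))).
  by rewrite ltn_pmul2r ?expn_gt0.
rewrite -expnD leq_pexp2l // -divn2.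
move: Ee; move: (A * 16 ^ 4)%N => D; lia.
Qed.

Lemma two_transitive_base (T : finType) (H : {group {perm T}}) C e r :
    two_transitive H -> (60 <= #|T|)%N -> ~~ ('Alt_T \subset H) ->
    (2 ^ e <= #|T| < 2 ^ e.+1)%N -> r = 32 ->
    (32 * (2 * r ^ 2 * r`!) ^ 2 * C.+1 * e.+1 < 2 ^ (e./2))%N ->
  exists b, [/\ (0 < b)%N, (C * b <= #|T|)%N & has_base H b].
Proof.
move=> tr2H n60 notA /andP[en ne] r32; set c := (2 * r ^ 2 * r`!)%N => small.
set n := #|T| in n60 en ne *.
(* As [t ^ 4 > n], a permutation of order at least [L ^ r >= t ^ 32] has order above [n ^ 8]. Its
   degree [j] is at most a constant times [n ^ (1/4)], so bases of size about [j ^ 2 * log n] are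
   still small. *)
pose t := (2 ^ (e %/ 4).+1)%N; pose L := (r`! * t)%N.
pose j := (r * (r * L).+1)%N.
have t0 : (0 < t)%N by rewrite expn_gt0.
have L0 : (0 < L)%N by rewrite muln_gt0 fact_gt0.
have jct : (j <= c * t)%N.
  have -> : (c * t = r * (2 * (r * L)))%N by rewrite /c /L !expnS expn0; ring.
  by rewrite leq_mul2l; have : (0 < r * L)%N; [rewrite muln_gt0 L0 r32 | lia].
have t2 : (t ^ 2 <= 4 * 2 ^ e./2)%N.
  rewrite /t -expnM -[4%N]/(2 ^ 2)%N -expnD leq_pexp2l // -divn2; lia.
have e2 : (2 ^ e./2 * 2 ^ e./2 <= n)%N.
  by apply: leq_trans en; rewrite -expnD leq_pexp2l // -divn2; lia.
have j2 : (j ^ 2 <= c ^ 2 * (4 * 2 ^ e./2))%N.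
  apply: (@leq_trans ((c * t) ^ 2)); first by rewrite leq_exp2r.
  by rewrite expnMn leq_mul2l t2 orbT.
have n_gt : (2 * j ^ 2 < n)%N by move: small e2 j2; nia.
have nl : (n ^ 2 < 2 ^ (2 * e.+1))%N by rewrite mulnC expnM ltn_exp2r.
case: (two_transitive_dichotomy tr2H _ n_gt nl) => [|[i /andP[i0 ij] baseH]|large].
- by apply: leq_trans n60.
- exists (4 * j * (2 * e.+1) * i)%N; split=> //.
    rewrite !muln_gt0 i0 /=; have : (0 < j)%N by apply: leq_ltn_trans ij.
    by lia.
  apply: leq_trans e2; apply: (@leq_trans (8 * C * e.+1 * j ^ 2)).
    rewrite -mulnn; nia.
  apply: (@leq_trans (8 * C * e.+1 * (c ^ 2 * (4 * 2 ^ e./2)))).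
    by rewrite leq_mul2l j2 orbT.
  rewrite mulnA mulnA leq_mul2r; apply/orP; right; apply: leq_trans (ltnW small).
  nia.
have [pi ord_pi] := ex_perm_order_ge (dvdn_mulr t (dvdnn r`!)).
have [h Hh ord_h] := large pi.
have ord_le : (#[h] <= n ^ 8)%N.
  apply: order_le_of_moved_gt Hh; first by apply: leq_trans n60.
  by move=> g Hg g1; apply: (two_transitive_moved_gt tr2H n60 notA Hg g1).
have := leq_trans ord_pi (leq_trans (dvdn_leq (order_gt0 h) ord_h) ord_le).
rewrite leqNgt => /negP[]; apply: (@leq_trans (t ^ r)).
  rewrite r32 (expnM t 4 8) ltn_exp2r //; apply: leq_trans ne _.
  by rewrite /t -expnM leq_pexp2l //; lia.
by rewrite leq_exp2r ?r32 // leq_pmull // fact_gt0.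
Qed.

Lemma primitive_base C : exists n0, forall (T : finType) (H : {group {perm T}}),
    (n0 <= #|T|)%N -> [primitive H, on [set: T] | 'P] ->
    H :!=: 'Alt_T -> H :!=: 'Sym_T ->
  exists b, [/\ (0 < b)%N, (C.+1 * b <= #|T|)%N & has_base H b].
Proof.
(* [r] is kept abstract so that [r`!] is never computed *)
have [r r32] : exists r, r = 32 by exists 32.
pose c := (32 * (2 * r ^ 2 * r`!) ^ 2 * C.+2)%N.
(* The summand [c] serves the 2-transitive case, and [(4 * C.+1) ^ 4] serves [uniprimitive_base]
   with [l = 2 * e.+1]. *)
have [E hE] := exp2_dominates (c + (4 * C.+1) ^ 4).
exists (2 ^ E + 60)%N => T H nT primH nA nS.
have n60 : (60 <= #|T|)%N by apply: leq_trans nT; rewrite leq_addl.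
pose e := trunc_log 2 #|T|.
have bnd : (2 ^ e <= #|T| < 2 ^ e.+1)%N by apply: trunc_log_bounds => //; lia.
have {}hE : ((c + (4 * C.+1) ^ 4) * e.+1 ^ 4 < 2 ^ e./2)%N.
  apply: hE; apply: trunc_log_max => //.
  by apply: leq_trans nT; rewrite leq_addr.
have [tr2H|ntr2H] := boolp.EM (two_transitive H).
  apply: (@two_transitive_base _ _ C.+1 e r) => //.
    apply/negP=> sA; have T1 : (1 < #|T|)%N by lia.
    by case: (Alt_sub_eq T1 sA) => eqH; [move: nA | move: nS]; rewrite eqH eqxx.
  apply: leq_ltn_trans hE; apply: leq_mul; first exact: leq_addr.
  by rewrite -{1}[e.+1]expn1 leq_pexp2l.
have [en ne] := andP bnd.
apply: (@uniprimitive_base _ _ C.+1 (2 * e.+1)) => //; first by lia.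
  by rewrite mulnC expnM ltn_exp2r.
apply: leq_trans en; rewrite (_ : 2 * (C.+1 * (2 * e.+1)) = 4 * C.+1 * e.+1)%N.
  rewrite expnMn; apply: leq_ltn_trans (leq_trans hE _).
    by rewrite leq_mul2r leq_addl orbT.
  by rewrite leq_pexp2l // -divn2 leq_div.
by ring.
Qed.

(** * Polynomial decay of [D_H] against powers of the logarithm *)

Lemma D_H_sqr_small M : exists n0, forall (T : finType) (H : {group {perm T}}),
    (n0 <= #|T|)%N -> [primitive H, on [set: T] | 'P] ->
    H :!=: 'Alt_T -> H :!=: 'Sym_T ->
  (D_H [set: {perm T}]%G H ^+ 2 <= #|T|%:R ^- M)%R.
Proof.
have [n0 base] := primitive_base (16 * M + 167); exists n0 => T H nT primH nA nS.
have [b [b0 Cb [B baseB]]] := base T H nT primH nA nS.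
apply: le_trans (D_H_sqr_le (subsetT _)) _.
apply: (small_base_sum (primitive_trans primH) baseB b0).
by move: Cb; rewrite -addnS.
Qed.

From mathcomp Require Import all_classical all_reals all_analysis.

Lemma fact_le_expn n : (n`! <= n ^ n)%N.
Proof.
elim: n => // n IHn; rewrite factS expnS leq_mul2l; apply/orP; right.
by apply: leq_trans IHn _; case: n => // n; rewrite leq_exp2r.
Qed.

Section RealBounds.
Local Open Scope ring_scope.
Variable R : realType.

Lemma algC_to_real_le (x : algC) (q : rat) : 0 <= x -> x <= ratr q ->
  algC_to_real R x <= ratr q.
Proof.
move=> x0 xq; apply: ge_sup.
  (* The supremum is over a nonempty set, since [x >= 0] puts 0 in it. *)
  by exists (ratr 0); exists 0; rewrite //= rmorph0.
by move=> _ [p /= px <-]; rewrite ler_rat -(ler_rat algC) (le_trans px).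
Qed.

Lemma ln_fact_le (n : nat) : (0 < n)%N -> ln (n`!%:R : R) <= n%:R ^+ 2.
Proof.
move=> n0; have n0R : 0 < n%:R :> R by rewrite ltr0n.
apply: (@le_trans _ _ (ln (n%:R ^+ n))).
  rewrite ler_ln ?posrE ?ltr0n ?fact_gt0 ?exprn_gt0 //.
  by rewrite -natrX ler_nat fact_le_expn.
rewrite lnXn // -[X in X <= _]mulr_natr expr2 ler_wpM2r ?ler0n //.
have /le_ln1Dx : -1 < n%:R - 1 :> R by rewrite ltrBrDr addNr.
by rewrite addrC subrK => /le_trans -> //; rewrite gerBl.
Qed.

Lemma powR_ln_fact_ge (n k : nat) (c : R) : (2 <= n)%N -> 0 < c -> c <= k%:R ->
  n%:R ^- (2 * k) <= powR (ln (n`!%:R : R)) (- c).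
Proof.
move=> n2 c0 ck.
have n1 : 1 <= n%:R ^+ 2 :> R.
  by rewrite -natrX ler1n expn_gt0 (leq_trans _ n2).
have ln0 : 0 < ln (n`!%:R : R).
  by rewrite ln_gt0 // ltr1n (leq_trans n2) //; apply: fact_geq.
rewrite powRN lef_pV2 ?posrE ?powR_gt0 ?exprn_gt0 ?ltr0n ?(leq_trans _ n2) //.
apply: (@le_trans _ _ (powR (n%:R ^+ 2) c)).
  apply: ge0_ler_powR; [exact: ltW | by rewrite nnegrE ltW | | ].
    by rewrite nnegrE exprn_ge0.
  by apply: ln_fact_le; apply: ltnW.
apply: (le_trans (ler_powR n1 ck)).
by rewrite powR_mulrn ?exprn_ge0 // -exprM.
Qed.

End RealBounds.

Theorem theorem3 (R : realType) (I : pred nat)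
    (H : forall n : nat, {group 'S_n}) :
  infinite_natset I ->
  (forall n, I n -> (0 < n)%N) ->
  (forall n, I n ->
     [primitive H n, on [set: 'I_n] | 'P]
     /\ (H n :!=: Alt 'I_n) /\ (H n :!=: Sym 'I_n)) ->
  indistinguishable R I (fun n => [set: 'S_n]%G) H.
Proof.
move=> infI _ primH [c [c0 [N dist]]].
have [k ck] : exists k : nat, (c <= k%:R)%R.
  by exists (Num.Def.archi_bound c); rewrite ltW // archi_boundP // ltW.
(* This exponent makes [D_H] at most [n ^- (2 * k).+1], strictly below [n ^- (2 * k)], which bounds
   the power of the logarithm from below because [ln n! <= n ^ 2]. *)
have [n0 small] := D_H_sqr_small ((2 * k).+1 * 2).
have [n [nbig In]] := infI (N + n0 + 2)%N.
have [prim [nA nS]] := primH n In.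
have {dist} := dist n In _; have Nn : (N <= n)%N by lia.
move=> /(_ Nn).
have n2 : (2 <= n)%N by lia.
have n0n : (n0 <= #|'I_n|)%N by rewrite card_ord; lia.
have := small 'I_n (H n) n0n prim nA nS; rewrite card_ord exprM -exprVn.
have n_gt0 (F : numDomainType) : (0 < n%:R :> F)%R by rewrite ltr0n ltnW.
rewrite ler_sqr ?nnegrE ?D_H_ge0 ?invr_ge0 ?exprn_ge0 ?ler0n // => DH_le.
rewrite leNgt => /negP[].
apply: (@le_lt_trans _ _ (ratr (n%:R ^- (2 * k).+1))).
  by apply: algC_to_real_le (D_H_ge0 _ _) _; rewrite fmorphV rmorphXn rmorph_nat.
rewrite fmorphV rmorphXn rmorph_nat.
have -> : #|[set: 'S_n]| = n`! by rewrite [LHS]card_Sym card_ord.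
apply: lt_le_trans _ (powR_ln_fact_ge n2 c0 ck).
by rewrite ltf_pV2 ?posrE ?exprn_gt0 ?n_gt0 // ltr_eXn2l ?ltr1n.
Qed.
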